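(* Let $\Omega\subset\mathbb{C}$ be a bounded domain and let $f\in C^1(\overline{\Omega})$ be a scalar complex-valued function that does not vanish in $\Omega$. Then the pseudoanalytic Bergman space $$\mathcal{A}_f^2(\Omega;\mathbb{B})=\left\{W\in C^1(\Omega;\mathbb{B})\cap L_2(\Omega;\mathbb{B})\;:\;\overline{\boldsymbol{\partial}}W=\frac{\overline{\boldsymbol{\partial}}f}{f}\,\overline{W}\ \text{in }\Omega\right\},$$ equipped with the inner product of $L_2(\Omega;\mathbb{B})$, is a complex Hilbert space.
   Context: $\mathbb{B}$ is the algebra of bicomplex numbers: the commutative unital $\mathbb{C}$-algebra of elements $W=u+\mathbf{j}v$ with $u,v\in\mathbb{C}$, where $\mathbf{j}^2=-1$ and $\mathbf{j}i=i\mathbf{j}$. Write $\operatorname{Sc}W=u$, $\operatorname{Vec}W=v$, and $\overline{W}=u-\mathbf{j}v$ (bicomplex conjugation). With $^*$ the usual complex conjugation, $\langle W,V\rangle_{\mathbb{B}}=\operatorname{Sc}W(\operatorname{Sc}V)^*+\operatorname{Vec}W(\operatorname{Vec}V)^*$ and $|W|_{\mathbb{B}}=\sqrt{\langle W,W\rangle_{\mathbb{B}}}$. A function $F:\Omega\to\mathbb{B}$ belongs to $C^k(\Omega;\mathbb{B})$ or $L_2(\Omega;\mathbb{B})$ iff $\operatorname{Sc}F$ and $\operatorname{Vec}F$ belong to $C^k(\Omega)$ or $L_2(\Omega)$ (complex-valued). The inner product is $\langle F,G\rangle_{L_2(\Omega;\mathbb{B})}=\iint_\Omega\langle F(z),G(z)\rangle_{\mathbb{B}}\,dA_z$,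 where $dA$ is area measure. The Bicomplex Cauchy-Riemann operator is $\overline{\boldsymbol{\partial}}=\frac12\left(\frac{\partial}{\partial x}+\mathbf{j}\frac{\partial}{\partial y}\right)$, with $z=x+iy$. ''Scalar'' means $\mathbb{C}$-valued. *)

(* Defs.v *)
From HB Require Import structures.
From mathcomp Require Import all_boot all_order all_algebra.
From mathcomp Require Import all_classical all_reals all_analysis.
From mathcomp Require Export complex.
From mathcomp Require Import ring.

Set Implicit Arguments.
Unset Strict Implicit.
Unset Printing Implicit Defensive.

Import Order.TTheory GRing.Theory Num.Theory.
Import numFieldNormedType.Exports.

Local Open Scope classical_set_scope.
Local Open Scope ring_scope.
Local Open Scope complex_scope.

(** * Bicomplex numbers [W = Sc W + j (Vec W)] *)

Record bicomplex (R : Type) := Bicomplex { Sc : R[i]; Vec : R[i] }.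

Section BicomplexAlgebra.
Context {R : rcfType}.
Local Notation B := (bicomplex R).
Implicit Types (W V U : B) (a b : R[i]).

Definition pair_of_bicomplex W := (Sc W, Vec W).
Definition bicomplex_of_pair (p : R[i] * R[i]) : B := Bicomplex p.1 p.2.

Lemma pair_of_bicomplexK : cancel pair_of_bicomplex bicomplex_of_pair.
Proof. by case. Qed.

HB.instance Definition _ := Equality.copy B (can_type pair_of_bicomplexK).
HB.instance Definition _ := Choice.copy B (can_type pair_of_bicomplexK).

Definition addb W V := Bicomplex (Sc W + Sc V) (Vec W + Vec V).
Definition oppb W := Bicomplex (- Sc W) (- Vec W).
Definition mulb W V :=
  Bicomplex (Sc W * Sc V - Vec W * Vec V) (Sc W * Vec V + Vec W * Sc V).
Definition scaleb a W := Bicomplex (a * Sc W) (a * Vec W).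

Lemma addbA : associative addb.
Proof. by move=> [? ?] [? ?] [? ?]; congr Bicomplex; rewrite /= addrA. Qed.
Lemma addbC : commutative addb.
Proof. by move=> [? ?] [? ?]; congr Bicomplex; rewrite /= addrC. Qed.
Lemma add0b : left_id (Bicomplex 0 0) addb.
Proof. by move=> [? ?]; congr Bicomplex; rewrite /= add0r. Qed.
Lemma addNb : left_inverse (Bicomplex 0 0) oppb addb.
Proof. by move=> [? ?]; congr Bicomplex; rewrite /= addNr. Qed.
HB.instance Definition _ := GRing.isZmodule.Build B addbA addbC add0b addNb.

Lemma mulbA : associative mulb.
Proof. by move=> [? ?] [? ?] [? ?]; congr Bicomplex; rewrite /=; ring. Qed.
Lemma mulbC : commutative mulb.
Proof. by move=> [? ?] [? ?]; congr Bicomplex; rewrite /=; ring. Qed.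
Lemma mul1b : left_id (Bicomplex 1 0) mulb.
Proof. by move=> [? ?]; congr Bicomplex; rewrite /=; ring. Qed.
Lemma mulbDl : left_distributive mulb addb.
Proof. by move=> [? ?] [? ?] [? ?]; congr Bicomplex; rewrite /=; ring. Qed.
Lemma oneb_neq0 : Bicomplex 1 0 != 0 :> B.
Proof. by apply/eqP => -[] /eqP; rewrite oner_eq0. Qed.
HB.instance Definition _ :=
  GRing.Zmodule_isComNzRing.Build B mulbA mulbC mul1b mulbDl oneb_neq0.

Lemma scalebA a b W : scaleb a (scaleb b W) = scaleb (a * b) W.
Proof. by congr Bicomplex; rewrite /= mulrA. Qed.
Lemma scale1b : left_id 1 scaleb.
Proof. by move=> [? ?]; congr Bicomplex; rewrite /= mul1r. Qed.
Lemma scalebDr : right_distributive scaleb +%R.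
Proof. by move=> ? [? ?] [? ?]; congr Bicomplex; rewrite /= mulrDr. Qed.
Lemma scalebDl W : {morph scaleb^~ W : a b / a + b}.
Proof. by move=> ? ?; congr Bicomplex; rewrite /= mulrDl. Qed.
HB.instance Definition _ :=
  GRing.Zmodule_isLmodule.Build R[i] B scalebA scale1b scalebDr scalebDl.

Lemma scalebAl a W V : a *: (W * V) = (a *: W) * V.
Proof. by congr Bicomplex; rewrite /=; ring. Qed.
HB.instance Definition _ := GRing.Lmodule_isLalgebra.Build R[i] B scalebAl.

Lemma scalebAr a W V : a *: (W * V) = W * (a *: V).
Proof. by rewrite mulrC scalebAl mulrC. Qed.
HB.instance Definition _ := GRing.Lalgebra_isAlgebra.Build R[i] B scalebAr.

Definition bj : B := Bicomplex 0 1.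

Definition conjb W : B := Bicomplex (Sc W) (- Vec W).

Definition dotb W V : R[i] := Sc W * (Sc V)^* + Vec W * (Vec V)^*.

End BicomplexAlgebra.

(** * Function spaces on a plane domain

    The complex plane is identified with [R * R] through [z = x + i y <-> (x, y)],
    so that topology, directional derivatives and area measure are those of the
    product [R * R].  *)

Section FunctionSpaces.
Context {R : realType}.
Local Notation plane := (R * R)%type.
Local Notation B := (bicomplex R).
Implicit Types (Omega : set plane) (g : plane -> R) (u : plane -> R[i])
  (F G W : plane -> B) (z : plane).

Definition bounded_domain Omega :=
  [/\ Omega !=set0, open Omega, connected Omega & bounded_set Omega].

Definition ex : plane := (1, 0).
Definition ey : plane := (0, 1).

Definition C1_real Omega g :=
  forall z, Omega z ->
    [/\ {for z, continuous g},
        derivable g z ex /\ {for z, continuous ('D_ex g)}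
      & derivable g z ey /\ {for z, continuous ('D_ey g)}].

(** [C1_real] up to the boundary: [g] is continuous on [closure Omega] and its
    partial derivatives extend continuously from [Omega] to [closure Omega]. *)
Definition C1_closure_real Omega g :=
  [/\ C1_real Omega g,
      {within closure Omega, continuous g},
      exists2 h : plane -> R, {within closure Omega, continuous h} &
        forall z, Omega z -> h z = 'D_ex g z
    & exists2 h : plane -> R, {within closure Omega, continuous h} &
        forall z, Omega z -> h z = 'D_ey g z].

Definition C1 Omega u :=
  C1_real Omega (fun z => complex.Re (u z)) /\ C1_real Omega (fun z => complex.Im (u z)).

Definition C1_closure Omega u :=
  C1_closure_real Omega (fun z => complex.Re (u z)) /\
  C1_closure_real Omega (fun z => complex.Im (u z)).

Local Notation mplane := (measurableTypeR R * measurableTypeR R)%type.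
Local Notation area := (@lebesgue_measure R \x @lebesgue_measure R)%E.

Definition L2 Omega u :=
  [/\ @measurable_fun _ _ mplane R Omega (fun z => complex.Re (u z)),
      @measurable_fun _ _ mplane R Omega (fun z => complex.Im (u z))
    & (\int[area]_(z in Omega) (ComplexField.Normc.normc (u z) ^+ 2)%:E < +oo)%E].

Definition cintegral Omega u : R[i] :=
  Rintegral area Omega (fun z => complex.Re (u z)) +i*
  Rintegral area Omega (fun z => complex.Im (u z)).

Definition C1b Omega F :=
  C1 Omega (fun z => Sc (F z)) /\ C1 Omega (fun z => Vec (F z)).

Definition L2b Omega F :=
  L2 Omega (fun z => Sc (F z)) /\ L2 Omega (fun z => Vec (F z)).

Definition dotL2b Omega F G : R[i] := cintegral Omega (fun z => dotb (F z) (G z)).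

Definition pderivc (v : plane) u z : R[i] :=
  'D_v (fun z => complex.Re (u z)) z +i* 'D_v (fun z => complex.Im (u z)) z.

Definition pderivb (v : plane) F z : B :=
  Bicomplex (pderivc v (fun z => Sc (F z)) z) (pderivc v (fun z => Vec (F z)) z).

Definition dbar F z : B := 2^-1 *: (pderivb ex F z + bj * pderivb ey F z).

(** A function on [Omega] is encoded by its extension by [0] to the plane, so
    that equality of functions on [Omega] is Leibniz equality; no other condition
    below looks at the values off the open set [Omega].  A complex scalar [c] is
    the bicomplex number [c%:A]. *)
Definition bergman Omega u : set (plane -> B) :=
  [set W | [/\ forall z, ~ Omega z -> W z = 0,
               C1b Omega W, L2b Omega W
             & forall z, Omega z ->
                 dbar W z =
                 ((u z)^-1 *: dbar (fun t => (u t)%:A) z) * conjb (W z)]].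

End FunctionSpaces.

(** * Complex Hilbert spaces

    [A] is the carrier, given as a subset of an ambient complex vector space. *)

Section Hilbert.
Context {R : realType} {V : lmodType R[i]}.
Implicit Types (A : set V) (dot : V -> V -> R[i]).

Definition complex_subspace A :=
  A 0 /\ forall (a : R[i]) u v, A u -> A v -> A (a *: u + v).

(** [0 < c] in [R[i]] says that [c] is real and positive. *)
Definition inner_product_on A dot :=
  [/\ forall (a : R[i]) u v w, A u -> A v -> A w ->
        dot (a *: u + v) w = a * dot u w + dot v w,
      forall u v, A u -> A v -> dot v u = (dot u v)^*
    & forall u, A u -> u <> 0 -> 0 < dot u u].

Definition dot_norm dot (u : V) : R := Num.sqrt (complex.Re (dot u u)).

Definition complete_on A dot :=
  forall w : nat -> V, (forall n, A (w n)) ->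
    (forall e : R, 0 < e -> exists N, forall m n, (N <= m)%N -> (N <= n)%N ->
       dot_norm dot (w m - w n) < e) ->
    exists2 l, A l & (fun n => dot_norm dot (w n - l)) @ \oo --> (0 : R).

Definition complex_hilbert_space A dot :=
  [/\ complex_subspace A, inner_product_on A dot & complete_on A dot].

End Hilbert.

(* Main.v *)
Require Import Defs.
From HB Require Import structures.
From mathcomp Require Import all_boot all_order all_algebra.
From mathcomp Require Import all_classical all_reals all_analysis.
From mathcomp Require Import ring lra.
From mathcomp Require Import measurable_realfun.

(** Only completeness and positivity of the norm need an argument, and both
    follow from an interior estimate ([interior_estimate]): near each point of
    [Omega] the values and the first derivatives of [W] are bounded by a constant,
    independent of [W], times the norm of [W] in [L2]. A Cauchy sequence of the
    space then converges locally uniformly together with its first derivatives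
    ([C1_real_limit]); the limit is of class [C1] and satisfies the equation, and
    Fatou's lemma ([fatou_le]) turns the pointwise convergence into convergence
    in [L2].

    Write [W = u + j v]. With [phi = u / f] and [psi = f v] the equation becomes
    the system [f^2 phi_x = psi_y], [f^2 phi_y = - psi_x]
    ([vekua_conductivity]), in which [f] occurs without derivatives. This is what
    makes first derivatives accessible: the coefficient of the original equation
    is merely continuous, whereas [f^2] is Lipschitz on small squares.

    Freeze the coefficient at a point [z] and put
    [h w = (f z)^2 phi w + j psi w]. The Cauchy-Riemann defect of [h] at [w] is
    bounded by a constant times [|w - z|] times the supremum of [|grad phi|]. Let
    [N rho] be the integral over the angles [t] of the real part of
    [h (z + rho exp(j t)) exp(- j t)]. Writing the Cauchy-Riemann operator in polar
    coordinates shows that [rho N' - N] is [rho] times an integral over the angles of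
    a combination of the two components of the defect, hence of order [rho^2],
    while [N' 0] is [2 pi] times a derivative of [h] at [z]. Integrating
    [(N / rho)'] bounds that derivative by a multiple of
    [sup |h| / r + r sup |grad phi|] ([derive0_le_quotient],
    [circle_mean_bound], [conductivity_gradient_bound]).

    Finally [sup |h|] is at most an [L2] mean over a smaller square plus a
    small multiple of [sup |grad phi|], and the gradients on the right-hand side
    are absorbed by working at the point where [|grad phi|], weighted by the
    squared distance to the boundary of a fixed square, is maximal
    ([gradient_absorption]). Neither second derivatives nor singular kernels are
    used. *)

Set Implicit Arguments.
Unset Strict Implicit.
Unset Printing Implicit Defensive.

Import Order.TTheory GRing.Theory Num.Theory.
Import numFieldNormedType.Exports.

Local Open Scope classical_set_scope.
Local Open Scope ring_scope.
Local Open Scope complex_scope.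

(** * Differential calculus in the plane *)

Section PlaneCalculus.
Context {R : realType}.
Local Notation plane := (R * R)%type.
Implicit Types (g p q : plane -> R) (z v : plane).

Lemma is_derive_line g z v (t : R) :
  derivable g (z + t *: v) v ->
  is_derive t 1 (fun s : R => g (z + s *: v)) ('D_v g (z + t *: v)).
Proof.
move=> dg.
have E : (fun h : R => h^-1 *: (((fun s => g (z + s *: v)) \o shift t) (h *: 1%R)
      - g (z + t *: v))) =
    (fun h : R => h^-1 *: ((g \o shift (z + t *: v)) (h *: v) - g (z + t *: v))).
  apply/funext => h /=; congr (_ *: (g _ - _)).
  by rewrite [h *: 1]mulr1 scalerDl addrCA.
by apply: DeriveDef; [rewrite /derivable E|rewrite /derive E].
Qed.

(** Mean value theorem along the line through [z] directed by [v]. *)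
Lemma MVT_line g z v (h : R) :
  (forall t, `|t| <= `|h| -> derivable g (z + t *: v) v) ->
  exists2 t, `|t| <= `|h| & g (z + h *: v) - g z = h * 'D_v g (z + t *: v).
Proof.
move=> dg.
have [h0|h0] := leP 0 h.
- have [t|t|c cI E] := @MVT_segment R (fun s => g (z + s *: v))
     (fun s => 'D_v g (z + s *: v)) 0 h h0.
  + rewrite in_itv /= => /andP[t0 th]; apply: is_derive_line; apply: dg.
    by rewrite !ger0_norm ?(ltW t0) ?(ltW th).
  + apply: derivable_within_continuous => s; rewrite in_itv /= => /andP[s0 sh].
    have [] := @is_derive_line g z v s => //.
    by apply: dg; rewrite !ger0_norm.
  move: cI; rewrite in_itv /= => /andP[c0 ch].
  exists c; first by rewrite !ger0_norm.
  by move: E; rewrite scale0r addr0 subr0 mulrC.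
- have [t|t|c cI E] := @MVT_segment R (fun s => g (z + s *: v))
     (fun s => 'D_v g (z + s *: v)) h 0 (ltW h0).
  + rewrite in_itv /= => /andP[t0 th]; apply: is_derive_line; apply: dg.
    by rewrite !ler0_norm ?(ltW h0) ?(ltW th)// lerN2 ltW.
  + apply: derivable_within_continuous => s; rewrite in_itv /= => /andP[s0 sh].
    have [] := @is_derive_line g z v s => //.
    by apply: dg; rewrite !ler0_norm ?(ltW h0)// lerN2.
  move: cI; rewrite in_itv /= => /andP[c0 ch].
  exists c; first by rewrite !ler0_norm ?(ltW h0)// lerN2.
  move: E; rewrite scale0r addr0 sub0r => E.
  by rewrite -opprB E mulrN opprK mulrC.
Qed.

Lemma scale_ex (a : R) : a *: ex = (a, 0) :> plane.
Proof. by congr pair; rewrite /GRing.scale/= ?mulr1 ?mulr0. Qed.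

Lemma scale_ey (a : R) : a *: ey = (0, a) :> plane.
Proof. by congr pair; rewrite /GRing.scale/= ?mulr1 ?mulr0. Qed.

Lemma planeE z (a b : R) : z + a *: ex + b *: ey = z + (a, b).
Proof. by rewrite scale_ex scale_ey -addrA; congr (_ + (_, _)); rewrite ?addr0 ?add0r. Qed.

Lemma plane_norm (a b : R) : `|(a, b) : plane| = Num.max `|a| `|b|.
Proof. by []. Qed.

(** The differential of [g] at [z], from the two partial derivatives. *)
Definition gradmap g z (v : plane) : R := v.1 * 'D_ex g z + v.2 * 'D_ey g z.

Lemma gradmap_linear g z : linear (gradmap g z).
Proof.
by move=> a u v; rewrite /gradmap /= /GRing.scale /=; ring.
Qed.

(** Continuous partial derivatives give total differentiability. *)
Lemma C1_is_diff (O : set plane) g z : nbhs z O -> C1_real O g ->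
  is_diff z g (gradmap g z).
Proof.
move=> nO C1g.
pose L := gradmap g z.
pose lin := GRing.isLinear.Build _ _ _ _ _ (gradmap_linear g z).
pose lL : {linear plane -> R} := HB.pack L lin.
have cL : continuous lL.
  move=> w; rewrite /lL /= /L /gradmap.
  by apply: cvgD; apply: cvgM; try exact: cvg_cst; [exact: cvg_fst|exact: cvg_snd].
have [_ [_ cx] [_ cy]] := C1g _ (nbhs_singleton nO).
have lit (e : R) : 0 < e ->
    \forall h \near (0 : plane), `|g (h + z) - (g z + L h)| <= e * `|h|.
  move=> {e}/posnumP[e].
  have e20 : 0 < e%:num / 2 by rewrite divr_gt0.
  have /nbhs_ballP[d /= d0 Hd] : \forall w \near z,
     [/\ O w, `|'D_ex g z - 'D_ex g w| < e%:num/2 &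
         `|'D_ey g z - 'D_ey g w| < e%:num/2].
    have /cvgrPdist_lt/(_ _ e20) A := cx.
    have /cvgrPdist_lt/(_ _ e20) B := cy.
    by apply: filterS3 nO A B => w; split.
  have Hd' w : `|w| < d -> [/\ O (z + w), `|'D_ex g z - 'D_ex g (z + w)| < e%:num/2 &
         `|'D_ey g z - 'D_ey g (z + w)| < e%:num/2].
    by move=> wd; apply: Hd; rewrite -ball_normE /= opprD addNKr normrN.
  near=> h.
  have hd : `|h| < d.
    near: h; apply/nbhs_ballP; exists d => //= w.
    by rewrite -ball_normE /= sub0r normrN.
  clear -C1g d0 Hd' hd.
  case: h hd => a b; rewrite plane_norm gt_max => /andP[ad bd].
  have [t ta E1] : exists2 t, `|t| <= `|a| & g (z + a *: ex) - g z = a * 'D_ex g (z + t *: ex).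
    apply: MVT_line => t ta; have [|Oz _ _] := Hd' (t *: ex).
      rewrite scale_ex plane_norm normr0 gt_max d0 andbT.
      exact: le_lt_trans ad.
    by have [_ []] := C1g _ Oz.
  have [s sb E2] : exists2 s, `|s| <= `|b| & g (z + a *: ex + b *: ey) - g (z + a *: ex)
      = b * 'D_ey g (z + a *: ex + s *: ey).
    apply: MVT_line => s sb; have [|Oz _ _] := Hd' (a, s).
      by rewrite plane_norm gt_max ad/= (le_lt_trans sb).
    by rewrite planeE; have [_ _ []] := C1g _ Oz.
  rewrite planeE in E2.
  have [|_ Ax _] := Hd' (t *: ex).
    rewrite scale_ex plane_norm normr0 gt_max d0 andbT.
    exact: le_lt_trans ad.
  have [|_ _ Ay] := Hd' (a, s).
    by rewrite plane_norm gt_max ad/= (le_lt_trans sb).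
  rewrite planeE in E2.
  rewrite /= /L /gradmap /=.
  have -> : g ((a, b) + z) - (g z + (a * 'D_ex g z + b * 'D_ey g z)) =
     a * ('D_ex g (z + t *: ex) - 'D_ex g z) + b * ('D_ey g (z + (a, s)) - 'D_ey g z).
    by rewrite (addrC _ z) !mulrBr -E1 -E2; ring.
  rewrite (le_trans (ler_normD _ _))// !normrM.
  have -> : e%:num * `|(a, b) : plane| =
      `|(a, b) : plane| * (e%:num/2) + `|(a, b) : plane| * (e%:num/2).
    by rewrite -mulrDr -splitr mulrC.
  apply: lerD; apply: ler_pM => //; rewrite ?plane_norm ?le_max ?lexx ?orbT//;
  by rewrite distrC ltW.
have H := iffRL (@eqaddoP R plane R^o plane (nbhs (0 : plane)) (g \o shift z)
  (cst (g z) + lL) id) lit.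
have E : 'd g z = L :> (plane -> R) := diff_unique cL H.
by split=> //; apply/diff_locallyP; rewrite E; split.
Unshelve. all: by end_near.
Qed.

End PlaneCalculus.

(** * Difference quotients and polar coordinates *)

Section Quotient.
Context {R : realType}.

(** As [a] runs over [(0, rho)], the quotient [N a / a] varies by at most [C rho];
    it tends to [N' 0] at [0]. *)
Lemma derive0_le_quotient (N dN : R -> R) (C r rho : R) :
  (forall a, `|a| < r -> is_derive a (1:R) N (dN a)) -> N 0 = 0 ->
  (forall a, 0 < a < r -> `|a * dN a - N a| <= C * a ^+ 2) ->
  0 < rho < r -> `|dN 0| <= `|N rho| / rho + C * rho.
Proof.
move=> NdN N0 Nb /andP[rho0 rhor].
have C0 : 0 <= C.
  have := Nb rho; rewrite rho0 rhor => /(_ isT) /(le_trans (normr_ge0 _)).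
  by rewrite pmulr_lge0// exprn_gt0.
have r0 : 0 < r by exact: lt_trans rhor.
have key e : 0 < e < rho -> `|e^-1 * N e| <= `|N rho| / rho + C * rho.
  move=> /andP[e0 er].
  have dq a : 0 < a -> a < r ->
      is_derive a (1:R) (fun s => s^-1 * N s) (a^-2 * (a * dN a - N a)).
    move=> a0 ar.
    have an0 : a != 0 by rewrite gt_eqF.
    have na : `|a| < r by rewrite gtr0_norm.
    have N1 := NdN a na.
    have i1 : is_derive a (1:R) (fun s : R => s^-1) (- a^-2).
      have Hd : derivable (@id R) a 1 by [].
      split; first exact: (@derivableV R R id a 1 an0 Hd).
      by rewrite (@deriveV R R id a 1 an0 Hd) derive_id [LHS]mulr1.
    have H := is_deriveM i1 N1.
    apply: is_derive_eq H _.
    by rewrite /GRing.scale /=; field.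
  have [x|x|c cI E] := @MVT_segment R (fun s => s^-1 * N s)
    (fun a => a^-2 * (a * dN a - N a)) e rho (ltW er).
  - by rewrite in_itv /= => /andP[ex xr]; apply: dq; [exact: lt_trans ex|exact: lt_trans rhor].
  - apply: derivable_within_continuous => s; rewrite in_itv /= => /andP[es sr].
    have [] // := dq s; [exact: lt_le_trans es|exact: le_lt_trans rhor].
  move: cI; rewrite in_itv /= => /andP[ec cr].
  have c0 : 0 < c by exact: lt_le_trans ec.
  have -> : e^-1 * N e = rho^-1 * N rho - c^-2 * (c * dN c - N c) * (rho - e).
    by rewrite -E opprB addrCA subrr addr0.
  rewrite (le_trans (ler_normB _ _))// lerD//.
    by rewrite normrM normfV (gtr0_norm rho0) mulrC.
  rewrite normrM ler_pM//.
    rewrite normrM normfV (ger0_norm (exprn_ge0 2 (ltW c0))).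
    rewrite ler_pdivrMl ?exprn_gt0// [leRHS]mulrC.
    by apply: Nb; rewrite c0 (le_lt_trans cr).
  by rewrite ger0_norm ?subr_ge0 ?(ltW er)// gerBl ltW.
have dN0 : is_derive (0:R) (1:R) N (dN 0) by apply: NdN; rewrite normr0.
have cvgN : e^-1 * N e @[e --> 0^'+] --> dN 0.
  have [/cvg_ex[/= l Hl] Hd] := dN0.
  have E : 'D_1 N 0 = l by exact: cvg_lim Hl.
  rewrite -Hd E.
  apply: cvg_trans; last by apply: cvg_dnbhs_at_right; exact: Hl.
  apply: near_eq_cvg; near=> h.
  by rewrite /= addr0 N0 subr0 /GRing.scale/= mulr1.
rewrite leNgt; apply/negP => lt.
have H := cvgr_norm_gt (dN 0) cvgN _ lt.
near (0 : R)^'+ => e.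
have : `|N rho| / rho + C * rho < `|e^-1 * N e| by near: e; exact: H.
rewrite ltNge key//; apply/andP; split; near: e.
  exact: nbhs_right_gt.
exact: nbhs_right_lt.
Unshelve. all: by end_near.
Qed.

End Quotient.

Section Circle.
Context {R : realType}.
Local Notation plane := (R * R)%type.
Implicit Types (g p q : plane -> R) (z v : plane).

(** Chain rule for [g] along the curve [(x, y)]. *)
Lemma is_derive_curve g (x y : R -> R) (t dx dy : R) :
  is_derive t (1 : R) x dx -> is_derive t (1 : R) y dy ->
  is_diff (x t, y t) g (gradmap g (x t, y t)) ->
  is_derive t (1 : R) (fun s => g (x s, y s))
    (dx * 'D_ex g (x t, y t) + dy * 'D_ey g (x t, y t)).
Proof.
move=> X Y G.
have diff1 (u : R -> R) du : is_derive t (1 : R) u du ->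
    is_diff t u (fun h => h * du).
  move=> U; have ud : derivable u t 1 by [].
  split; first exact/derivable1_diffP.
  by rewrite deriv1E// derive1E derive_val.
have := is_diff_comp (is_diff_pair (diff1 _ _ X) (diff1 _ _ Y)) G.
rewrite /comp /= => -[Hd Hv].
split; first exact: diff_derivable.
by rewrite deriveE// Hv /gradmap /= !mul1r.
Qed.

(** The point at angle [t] on the circle of centre [z] and signed radius [a]. *)
Definition circ z (a t : R) : plane := (z.1 + a * cos t, z.2 + a * sin t).

Lemma circ_ball z (a t r : R) : `|a| < r -> ball z r (circ z a t).
Proof.
move=> ar; rewrite -ball_normE /=; case: z => x y.
have -> : (x, y) - circ (x, y) a t = (- (a * cos t), - (a * sin t)) :> plane.
  by congr pair; rewrite /= opprD addrA subrr add0r.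
rewrite plane_norm gt_max !normrN !normrM.
by apply/andP; split; apply: le_lt_trans ar; rewrite ler_piMr// ?cos_max ?sin_max.
Qed.

(** The norm of [plane] is the maximum norm, so that the circle of radius [a]
    lies in the square of half-side [a]. *)
Lemma circ_dist z (a t : R) : `|z - circ z a t| <= `|a|.
Proof.
case: z => x y.
have -> : (x, y) - circ (x, y) a t = (- (a * cos t), - (a * sin t)) :> plane.
  by congr pair; rewrite /= opprD addrA subrr add0r.
rewrite plane_norm ge_max !normrN !normrM.
by apply/andP; split; rewrite ler_piMr// ?cos_max ?sin_max.
Qed.

Lemma circ_continuous z a : continuous (circ z a).
Proof.
move=> t; apply: (@cvg_pair _ _ _ _ (nbhs (z.1 + a * cos t))
  (nbhs (z.2 + a * sin t))).
  by apply: cvgD; [exact: cvg_cst|apply: cvgM; [exact: cvg_cst|exact: continuous_cos]].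
by apply: cvgD; [exact: cvg_cst|apply: cvgM; [exact: cvg_cst|exact: continuous_sin]].
Qed.

Lemma circ_comp_continuous g z (a r : R) : `|a| < r ->
  (forall w, ball z r w -> {for w, continuous g}) ->
  continuous (fun t => g (circ z a t)).
Proof.
move=> ar cg t.
apply: (@continuous_comp _ _ _ (circ z a) g t); first exact: circ_continuous.
exact/cg/circ_ball.
Qed.

Variables (z : plane) (r : R).

Let diff_on g w : C1_real (ball z r) g -> ball z r w -> is_diff w g (gradmap g w).
Proof.
move=> C1g wr; apply: (@C1_is_diff R (ball z r)) => //.
by apply: open_nbhs_nbhs; split => //; exact: ball_open.
Qed.

Lemma is_derive_radius g a t : C1_real (ball z r) g -> `|a| < r ->
  is_derive a (1 : R) (fun s => g (circ z s t))
    (cos t * 'D_ex g (circ z a t) + sin t * 'D_ey g (circ z a t)).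
Proof.
move=> C1g ar; apply: is_derive_curve; last exact/diff_on/circ_ball.
  have -> : (fun s : R => z.1 + s * cos t) = cst z.1 + (cos t *: @id R).
    by apply/funext => s; rewrite [in RHS]fctE/= [in RHS]/GRing.scale/= mulrC.
  by apply: (is_derive_eq (is_deriveD (is_derive_cst z.1 a (1 : R))
    (is_deriveZ (cos t) (is_derive_id a (1 : R))))); rewrite add0r [LHS]mulr1.
have -> : (fun s : R => z.2 + s * sin t) = cst z.2 + (sin t *: @id R).
  by apply/funext => s; rewrite [in RHS]fctE/= [in RHS]/GRing.scale/= mulrC.
by apply: (is_derive_eq (is_deriveD (is_derive_cst z.2 a (1 : R))
    (is_deriveZ (sin t) (is_derive_id a (1 : R))))); rewrite add0r [LHS]mulr1.
Qed.

Lemma is_derive_angle g a t : C1_real (ball z r) g -> `|a| < r ->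
  is_derive t (1 : R) (fun s => g (circ z a s))
    (- (a * sin t) * 'D_ex g (circ z a t) + a * cos t * 'D_ey g (circ z a t)).
Proof.
move=> C1g ar; apply: is_derive_curve; last exact/diff_on/circ_ball.
  have -> : (fun s : R => z.1 + a * cos s) = cst z.1 + (a *: @cos R).
    by apply/funext => s; rewrite [in RHS]fctE.
  by apply: (is_derive_eq (is_deriveD (is_derive_cst z.1 t (1 : R))
    (is_deriveZ a (is_derive_cos t)))); rewrite add0r -[LHS]/(a * - sin t) mulrN.
have -> : (fun s : R => z.2 + a * sin s) = cst z.2 + (a *: @sin R).
  by apply/funext => s; rewrite [in RHS]fctE.
by apply: (is_derive_eq (is_deriveD (is_derive_cst z.2 t (1 : R))
    (is_deriveZ a (is_derive_sin t)))); rewrite add0r.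
Qed.

End Circle.

(** * A derivative bound from means over circles *)

Section CircleMean.
Context {R : realType}.
Local Notation plane := (R * R)%type.
Local Notation mu := (@lebesgue_measure R).
Implicit Types (g : plane -> R).
Variables (z : plane) (r : R) (p q : plane -> R).
Hypothesis r0 : 0 < r.
Hypothesis C1p : C1_real (ball z r) p.
Hypothesis C1q : C1_real (ball z r) q.

Variables (K M S : R).
Hypothesis boundM : forall w, ball z r w ->
  [/\ `|'D_ex p w| <= M, `|'D_ey p w| <= M, `|'D_ex q w| <= M & `|'D_ey q w| <= M].
Hypothesis CR : forall w, ball z r w ->
  `|'D_ex p w - 'D_ey q w| <= K * `|z - w| /\
  `|'D_ey p w + 'D_ex q w| <= K * `|z - w|.
Hypothesis boundS : forall w, ball z r w -> `|p w| + `|q w| <= S.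

(** [F] is the real part of [(p + j q) * exp(- j t)] on the circle of radius [a], and
    [dF] its derivative in [a]; [E] is the imaginary part, and [dE] its derivative
    in the angle [t]. The combination [G] of the Cauchy-Riemann defects is what
    prevents [F / a] from having derivative [dE / a^2] in [a]. *)
Let F (a t : R) : R := p (circ z a t) * cos t + q (circ z a t) * sin t.
Let dF (a t : R) : R :=
  (cos t * 'D_ex p (circ z a t) + sin t * 'D_ey p (circ z a t)) * cos t +
  (cos t * 'D_ex q (circ z a t) + sin t * 'D_ey q (circ z a t)) * sin t.
Let E (a t : R) : R := q (circ z a t) * cos t - p (circ z a t) * sin t.
Let dE (a t : R) : R :=
  (- (a * sin t) * 'D_ex q (circ z a t) + a * cos t * 'D_ey q (circ z a t)) * cos t
  - q (circ z a t) * sin t -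
  ((- (a * sin t) * 'D_ex p (circ z a t) + a * cos t * 'D_ey p (circ z a t)) * sin t
  + p (circ z a t) * cos t).
Let G (a t : R) : R :=
  ('D_ex p (circ z a t) - 'D_ey q (circ z a t)) * (cos t ^+ 2 - sin t ^+ 2) +
  ('D_ey p (circ z a t) + 'D_ex q (circ z a t)) * (2 * (sin t * cos t)).

Let dF_E a t : a * dF a t - F a t = dE a t + a * G a t.
Proof. by rewrite /dF /F /dE /G; ring. Qed.

Let is_derive_F a t : `|a| < r -> is_derive a (1 : R) (fun s => F s t) (dF a t).
Proof.
move=> ar.
have Dp := is_derive_radius t C1p ar.
have Dq := is_derive_radius t C1q ar.
have -> : (fun s => F s t) = (cos t *: (fun s => p (circ z s t))) +
    (sin t *: (fun s => q (circ z s t))).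
  apply/funext => s; rewrite /F ![in RHS]fctE.
  by congr (_ + _); rewrite [in RHS]/GRing.scale/= mulrC.
apply: (is_derive_eq (is_deriveD (is_deriveZ (cos t) Dp) (is_deriveZ (sin t) Dq))).
rewrite /dF /GRing.scale/=; ring.
Qed.

Let is_derive_E a t : `|a| < r -> is_derive t (1 : R) (E a) (dE a t).
Proof.
move=> ar.
have Dp := is_derive_angle t C1p ar.
have Dq := is_derive_angle t C1q ar.
have -> : E a = (fun s => q (circ z a s)) * cos - (fun s => p (circ z a s)) * sin.
  by [].
apply: (is_derive_eq (is_deriveB (is_deriveM Dq (is_derive_cos t))
  (is_deriveM Dp (is_derive_sin t)))).
rewrite /dE /GRing.scale/=; ring.
Qed.

Let cts g a : `|a| < r -> (forall w, ball z r w -> {for w, continuous g}) ->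
  continuous (fun t => g (circ z a t)).
Proof. exact: circ_comp_continuous. Qed.

Let ccos : continuous (@cos R). Proof. exact: continuous_cos. Qed.
Let csin : continuous (@sin R). Proof. exact: continuous_sin. Qed.
Let ccst (c : R) : continuous (fun _ : R => c). Proof. by move=> ?; exact: cvg_cst. Qed.

Let cp a : `|a| < r -> continuous (fun t => p (circ z a t)).
Proof. by move=> ar; apply: cts => // w /C1p[]. Qed.
Let cq a : `|a| < r -> continuous (fun t => q (circ z a t)).
Proof. by move=> ar; apply: cts => // w /C1q[]. Qed.
Let cpx a : `|a| < r -> continuous (fun t => 'D_ex p (circ z a t)).
Proof. by move=> ar; apply: (@cts ('D_ex p)) => // w /C1p[_ [_ H] _]. Qed.
Let cpy a : `|a| < r -> continuous (fun t => 'D_ey p (circ z a t)).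
Proof. by move=> ar; apply: (@cts ('D_ey p)) => // w /C1p[_ _ [_ H]]. Qed.
Let cqx a : `|a| < r -> continuous (fun t => 'D_ex q (circ z a t)).
Proof. by move=> ar; apply: (@cts ('D_ex q)) => // w /C1q[_ [_ H] _]. Qed.
Let cqy a : `|a| < r -> continuous (fun t => 'D_ey q (circ z a t)).
Proof. by move=> ar; apply: (@cts ('D_ey q)) => // w /C1q[_ _ [_ H]]. Qed.

Let cD (f g : R -> R) : continuous f -> continuous g -> continuous (fun t => f t + g t).
Proof. by move=> cf cg t; apply: cvgD; [exact: cf|exact: cg]. Qed.
Let cM (f g : R -> R) : continuous f -> continuous g -> continuous (fun t => f t * g t).
Proof. by move=> cf cg t; apply: cvgM; [exact: cf|exact: cg]. Qed.
Let cN (f : R -> R) : continuous f -> continuous (fun t => - f t).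
Proof. by move=> cf t; apply: cvgN; exact: cf. Qed.

Let cabs (f : R -> R) : continuous f -> continuous (fun t => `|f t|).
Proof. by move=> cf t; apply: continuous_comp; [exact: cf|exact: norm_continuous]. Qed.

Let cF a : `|a| < r -> continuous (F a).
Proof. move=> ar; exact: (cD (cM (cp ar) ccos) (cM (cq ar) csin)). Qed.

Let cdF a : `|a| < r -> continuous (dF a).
Proof.
move=> ar; exact: (cD (cM (cD (cM ccos (cpx ar)) (cM csin (cpy ar))) ccos)
                      (cM (cD (cM ccos (cqx ar)) (cM csin (cqy ar))) csin)).
Qed.

Let cdE a : `|a| < r -> continuous (dE a).
Proof.
move=> ar.
rewrite /dE; exact (cD
  (cD (cM (cD (cM (cN (cM (@ccst a) csin)) (cqx ar)) (cM (cM (@ccst a) ccos) (cqy ar)))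
          ccos)
      (cN (cM (cq ar) csin)))
  (cN (cD
      (cM (cD (cM (cN (cM (@ccst a) csin)) (cpx ar)) (cM (cM (@ccst a) ccos) (cpy ar)))
          csin)
      (cM (cp ar) ccos)))).
Qed.

Let cG a : `|a| < r -> continuous (G a).
Proof.
move=> ar; exact: (cD
  (cM (cD (cpx ar) (cN (cqy ar))) (cD (cM ccos ccos) (cN (cM csin csin))))
  (cM (cD (cpy ar) (cqx ar)) (cM (@ccst 2) (cM csin ccos)))).
Qed.

Let I : set R := `[0, pi *+ 2]%classic.
Let mI : measurable (I : set (measurableTypeR R)).
Proof. exact: measurable_itv. Qed.

Let intI (h : R -> R) : continuous h -> mu.-integrable I (EFin \o h).
Proof.
move=> ch; apply: continuous_compact_integrable; first exact: segment_compact.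
exact: continuous_subspaceT.
Qed.

Let pi20 : 0 < (pi : R) *+ 2. Proof. by rewrite pmulrn_lgt0 ?pi_gt0. Qed.

Let muI : fine (mu I) = pi *+ 2.
Proof. by rewrite /I lebesgue_measure_itv /= lte_fin pi20/= subr0. Qed.

(** The integral [N] of [F] over the angles, and its derivative. *)
Let N (a : R) : R := Rintegral mu I (F a).
Let dN (a : R) : R := Rintegral mu I (dF a).

Let is_derive_N a : `|a| < r -> is_derive a (1 : R) N (dN a).
Proof.
move=> ar.
have M0 : 0 <= M.
  by have [+ _ _ _] := boundM (circ_ball z 0 ar); apply: le_trans.
have Ia : `]- r, r[%classic a by rewrite /= in_itv/= -ltr_norml.
have h1 x : `]- r, r[%classic x -> mu.-integrable I (EFin \o F x).
  by rewrite /= in_itv/= -ltr_norml => xr; exact/intI/cF.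
have h2 x y : `]- r, r[%classic x -> I y -> derivable (F ^~ y) x 1.
  by rewrite /= in_itv/= -ltr_norml => xr _; case: (is_derive_F y xr).
have h3 x y : `]- r, r[%classic x -> I y -> `|partial1of2 F x y| <= cst (4 * M) y.
  rewrite /= in_itv/= -ltr_norml => xr _.
  rewrite /partial1of2 derive1E; have -> := @derive_val _ _ _ _ _ _ _ (is_derive_F y xr).
  have [b1 b2 b3 b4] := boundM (circ_ball z y xr).
  have c1 := cos_max y; have s1 := sin_max y.
  have aux (u v : R) : `|u| <= 1 -> `|v| <= M -> `|u * v| <= M.
    by move=> u1 vM; rewrite normrM (le_trans _ vM)// ler_piMl.
  have aux2 (u v : R) : `|u| <= 1 -> `|v| <= M + M -> `|v * u| <= M + M.
    by move=> u1 vM; rewrite normrM (le_trans _ vM)// ler_piMr.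
  rewrite (_ : 4 * M = (M + M) + (M + M)); last by ring.
  by rewrite (le_trans (ler_normD _ _))// lerD// aux2// (le_trans (ler_normD _ _))//
    lerD// aux.
have h4 (y : R) : (0 : R) <= cst (4 * M) y by exact: mulr_ge0 (ler0n _ _) M0.
have h5 : mu.-integrable I (EFin \o cst (4 * M)) by exact/intI/ccst.
split; first exact (derivable_under_integral mI Ia h1 h2 h4 h5 h3).
rewrite -derive1E (differentiation_under_integral mI Ia h1 h2 h4 h5 h3).
apply: eq_Rintegral => y _; rewrite /partial1of2 derive1E.
exact: (@derive_val _ _ _ _ _ _ _ (is_derive_F y ar)).
Qed.

Let int_dE a : `|a| < r -> Rintegral mu I (dE a) = 0.
Proof.
move=> ar; rewrite /Rintegral /I.
have cE : continuous (E a).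
  move=> t; apply/differentiable_continuous/derivable1_diffP.
  by have [] := is_derive_E t ar.
rewrite (@continuous_FTC2 _ (dE a) (E a))//=.
- by rewrite /E /circ cos2pi sin2pi cos0 sin0 /= subrr.
- exact/continuous_subspaceT/cdE.
- split.
  + by move=> t _; have [] := is_derive_E t ar.
  + exact/cvg_at_right_filter/cE.
  + exact/cvg_at_left_filter/cE.
- by move=> t _; rewrite derive1E; exact: (@derive_val _ _ _ _ _ _ _ (is_derive_E t ar)).
Qed.

Let r20 : 0 < r / 2. Proof. by rewrite divr_gt0. Qed.
Let r2r : r / 2 < r. Proof. by rewrite ltr_pdivrMr// ltr_pMr// ltr1n. Qed.
Let nr2 : `|r / 2| < r. Proof. by rewrite gtr0_norm. Qed.

Let G_bound a t : `|a| < r -> `|G a t| <= 2 * (K * `|a|).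
Proof.
move=> ar; have [b1 b2] := CR (circ_ball z t ar).
have g1 : `|cos t ^+ 2 - sin t ^+ 2| <= 1.
  have := cos2Dsin2 t; have := sqr_ge0 (cos t); have := sqr_ge0 (sin t).
  by move=> h1 h2 h3; rewrite ler_norml; apply/andP; split; lra.
have g2 : `|2 * (sin t * cos t)| <= 1.
  have := cos2Dsin2 t; have := sqr_ge0 (cos t + sin t); have := sqr_ge0 (cos t - sin t).
  by move=> h1 h2 h3; rewrite ler_norml; apply/andP; split; nra.
have c1 := circ_dist z a t.
have K0 : 0 <= K.
  have [+ _] := CR (circ_ball z 0 nr2).
  move=> /(le_trans (normr_ge0 _)); rewrite pmulr_lge0//.
  rewrite /circ sin0 cos0 mulr0 mulr1 addr0.
  have -> : z - (z.1 + r / 2, z.2) = (- (r / 2), 0) :> plane.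
    by case: (z) => x y; congr pair; rewrite /= ?subrr// opprD addrA subrr add0r.
  by rewrite plane_norm normrN normr0 lt_max normr_gt0 gt_eqF.
have aux (u v : R) : `|u| <= K * `|z - circ z a t| -> `|v| <= 1 -> `|u * v| <= K * `|a|.
  move=> hu hv; rewrite normrM -[leRHS]mulr1 ler_pM//.
  by rewrite (le_trans hu)// ler_wpM2l.
rewrite (_ : 2 * (K * `|a|) = K * `|a| + K * `|a|); last by ring.
by rewrite (le_trans (ler_normD _ _))// lerD// aux.
Qed.

(** If the Cauchy-Riemann defect of [p + j q] is [O(|w - z|)], the derivative of
    [p] at [z] is bounded by the size of [p] and [q] alone, up to
    [K r]: the bound [M] only serves to differentiate under the integral sign. *)
Lemma circle_mean_bound : `|'D_ex p z| <= 2 * S / r + K * r.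
Proof.
have zr : ball z r z by exact: ballxx.
have r00 : `|0 : R| < r by rewrite normr0.
have circ0 t : circ z 0 t = z.
  by rewrite /circ !mul0r !addr0; case: (z).
(* [F 0] is, up to sign, an exact derivative in the angle. *)
have N0 : N 0 = 0.
  have E0 : F 0 = (fun t => (-1) * dE 0 t).
    apply/funext => t; have := dF_E 0 t; rewrite !mul0r addr0 sub0r => <-.
    by rewrite mulN1r opprK.
  by rewrite /N E0 (RintegralZl _ mI (intI (cdE r00))) int_dE ?mulr0.
(* At the centre the Cauchy-Riemann equations hold exactly. *)
have dN0 : dN 0 = 'D_ex p z * (pi *+ 2).
  have [] := CR zr; rewrite subrr normr0 mulr0 !normr_le0 subr_eq0 => /eqP e1 /eqP e2.
  have E0 : dF 0 = (fun=> 'D_ex p z).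
    apply/funext => t; rewrite /dF !circ0.
    have -> : 'D_ex q z = - 'D_ey p z by apply/eqP; rewrite -addr_eq0 addrC e2.
    rewrite -e1 -[RHS]mulr1 -(cos2Dsin2 t); ring.
  by rewrite /dN E0 (Rintegral_cst _ mI) muI.
have Nb a : 0 < a < r -> `|a * dN a - N a| <= (pi *+ 2 * (2 * K)) * a ^+ 2.
  move=> /andP[a0 ar].
  have na : `|a| < r by rewrite gtr0_norm.
    have E1 : a * dN a - N a = Rintegral mu I (fun t => a * G a t).
    rewrite /dN /N -(RintegralZl _ mI (intI (cdF na))).
    rewrite -(RintegralB mI (intI (cM (@ccst a) (cdF na))) (intI (cF na))).
    transitivity (Rintegral mu I (fun t => dE a t + a * G a t)).
      by apply: eq_Rintegral => t _; rewrite dF_E.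
    rewrite (RintegralD mI (intI (cdE na)) (intI (cM (@ccst a) (cG na)))).
    by rewrite int_dE// add0r.
  have caG : continuous (fun t => a * G a t) by exact: (cM (@ccst a) (cG na)).
  rewrite E1 (le_trans (le_normr_Rintegral mI (intI caG)))//.
  apply: (@le_trans _ _ (Rintegral mu I (fun=> 2 * K * a ^+ 2))).
    apply: (le_Rintegral mI (intI (cabs caG)) (intI (@ccst _))).
    move=> t _; rewrite normrM (gtr0_norm a0).
    rewrite (_ : 2 * K * a ^+ 2 = a * (2 * (K * a))); last by ring.
    by rewrite ler_pM2l// -{2}(gtr0_norm a0) G_bound.
  rewrite (Rintegral_cst _ mI) muI.
  rewrite (_ : 2 * K * a ^+ 2 * (pi *+ 2) = (pi *+ 2) * (2 * K) * a ^+ 2)//.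
  by ring.
have rho : 0 < r / 2 < r by rewrite r20 r2r.
have := derive0_le_quotient is_derive_N N0 Nb rho.
have NS : `|N (r / 2)| <= S * (pi *+ 2).
  rewrite /N (le_trans (le_normr_Rintegral mI (intI (cF nr2))))//.
  apply: (@le_trans _ _ (Rintegral mu I (fun=> S))).
    apply: (le_Rintegral mI (intI (cabs (cF nr2))) (intI (@ccst _))).
    move=> t _; rewrite /F (le_trans _ (boundS (circ_ball z t nr2)))//.
    rewrite (le_trans (ler_normD _ _))// lerD// normrM ler_piMr ?cos_max ?sin_max//.
  by rewrite (Rintegral_cst _ mI) muI.
rewrite dN0 normrM (gtr0_norm pi20) => H.
rewrite -(ler_pM2r pi20) (le_trans H)//.
rewrite (_ : (2 * S / r + K * r) * (pi *+ 2) =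
  S * (pi *+ 2) / (r / 2) + pi *+ 2 * (2 * K) * (r / 2)); last first.
  by field; rewrite gt_eqF.
by rewrite lerD2r ler_pM2r// invr_gt0; lra.
Qed.

End CircleMean.

(** * Functions of class C1 *)

Section C1Calculus.
Context {R : realType}.
Local Notation plane := (R * R)%type.
Implicit Types (O : set plane) (g h : plane -> R) (u w : plane -> R[i]) (z v : plane).

(** [C1_real] from explicit formulas for the partial derivatives, required in the
    open set [O] only. *)
Lemma C1_realI O g gx gy : open O ->
  (forall z, O z -> is_derive z (ex : plane) g (gx z)) ->
  (forall z, O z -> is_derive z (ey : plane) g (gy z)) ->
  (forall z, O z -> [/\ {for z, continuous g}, {for z, continuous gx} &
    {for z, continuous gy}]) -> C1_real O g.
Proof.
move=> oO Hx Hy Hc z Oz; have [c cx cy] := Hc z Oz.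
have nO : nbhs z O by exact: open_nbhs_nbhs.
have aux (v : plane) (gv : plane -> R) : (forall z, O z -> is_derive z v g (gv z)) ->
    {for z, continuous gv} -> derivable g z v /\ {for z, continuous ('D_v g)}.
  move=> Hv cv; have dv := Hv z Oz; split; first by [].
  have E t : O t -> gv t = 'D_v g t by move=> Ot; have [_ ->] := Hv t Ot.
  move: cv; rewrite /prop_for /continuous_at -(E z Oz); apply: cvg_trans.
  by apply: near_eq_cvg; apply: filterS nO => t Ot; rewrite -E.
split=> //; exact: aux.
Qed.

Lemma C1_real_is_derive O g z : C1_real O g -> O z ->
  is_derive z (ex : plane) g ('D_ex g z) /\ is_derive z (ey : plane) g ('D_ey g z).
Proof. by move=> C1g /C1g[_ [dx _] [dy _]]; split; exact: derivableP. Qed.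

Lemma C1_realD O g h : open O -> C1_real O g -> C1_real O h ->
  C1_real O (fun z => g z + h z).
Proof.
move=> oO C1g C1h.
apply: (@C1_realI O _ (fun z => 'D_ex g z + 'D_ex h z) (fun z => 'D_ey g z + 'D_ey h z) oO).
- move=> z Oz; have [gx _] := C1_real_is_derive C1g Oz.
  by have [hx _] := C1_real_is_derive C1h Oz; exact: (is_deriveD gx hx).
- move=> z Oz; have [_ gx] := C1_real_is_derive C1g Oz.
  by have [_ hx] := C1_real_is_derive C1h Oz; exact: (is_deriveD gx hx).
- move=> z Oz; have [g0 [_ gx] [_ gy]] := C1g z Oz; have [h0 [_ hx] [_ hy]] := C1h z Oz.
  by split; [exact: (cvgD g0 h0)|exact: (cvgD gx hx)|exact: (cvgD gy hy)].
Qed.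

Lemma C1_realN O g : open O -> C1_real O g -> C1_real O (fun z => - g z).
Proof.
move=> oO C1g.
apply: (@C1_realI O _ (fun z => - 'D_ex g z) (fun z => - 'D_ey g z) oO).
- by move=> z Oz; have [gx _] := C1_real_is_derive C1g Oz; exact: (is_deriveN gx).
- by move=> z Oz; have [_ gx] := C1_real_is_derive C1g Oz; exact: (is_deriveN gx).
- move=> z Oz; have [g0 [_ gx] [_ gy]] := C1g z Oz.
  by split; [exact: (cvgN g0)|exact: (cvgN gx)|exact: (cvgN gy)].
Qed.

Lemma C1_realM O g h : open O -> C1_real O g -> C1_real O h ->
  C1_real O (fun z => g z * h z).
Proof.
move=> oO C1g C1h.
apply: (@C1_realI O _ (fun z => g z * 'D_ex h z + h z * 'D_ex g z)
   (fun z => g z * 'D_ey h z + h z * 'D_ey g z) oO).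
- move=> z Oz; have [gx _] := C1_real_is_derive C1g Oz.
  by have [hx _] := C1_real_is_derive C1h Oz; exact: (is_deriveM gx hx).
- move=> z Oz; have [_ gx] := C1_real_is_derive C1g Oz.
  by have [_ hx] := C1_real_is_derive C1h Oz; exact: (is_deriveM gx hx).
- move=> z Oz; have [g0 [_ gx] [_ gy]] := C1g z Oz; have [h0 [_ hx] [_ hy]] := C1h z Oz.
  split; [exact: (cvgM g0 h0)|exact: (cvgD (cvgM g0 hx) (cvgM h0 gx))|].
  exact: (cvgD (cvgM g0 hy) (cvgM h0 gy)).
Qed.

Lemma C1_realV O g : open O -> (forall z, O z -> g z != 0) -> C1_real O g ->
  C1_real O (fun z => (g z)^-1).
Proof.
move=> oO g0 C1g.
apply: (@C1_realI O _ (fun z => - ((g z)^-1 * (g z)^-1) * 'D_ex g z)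
   (fun z => - ((g z)^-1 * (g z)^-1) * 'D_ey g z) oO).
- move=> z Oz; have [_ [gx _] _] := C1g z Oz.
  have gz := g0 z Oz; split; first exact: derivableV.
  by rewrite deriveV// expr2 invfM.
- move=> z Oz; have [_ _ [gx _]] := C1g z Oz.
  have gz := g0 z Oz; split; first exact: derivableV.
  by rewrite deriveV// expr2 invfM.
- move=> z Oz; have [gc [_ gx] [_ gy]] := C1g z Oz.
  have cV : {for z, continuous (fun z => (g z)^-1)} by apply: cvgV; [exact: g0|exact: gc].
  split; [exact: cV|exact: (cvgM (cvgN (cvgM cV cV)) gx)|].
  exact: (cvgM (cvgN (cvgM cV cV)) gy).
Qed.

Lemma ReD (a b : R[i]) : complex.Re (a + b) = complex.Re a + complex.Re b.
Proof. by case: a b => ? ? []. Qed.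
Lemma ImD (a b : R[i]) : complex.Im (a + b) = complex.Im a + complex.Im b.
Proof. by case: a b => ? ? []. Qed.
Lemma ReN (a : R[i]) : complex.Re (- a) = - complex.Re a.
Proof. by case: a. Qed.
Lemma ImN (a : R[i]) : complex.Im (- a) = - complex.Im a.
Proof. by case: a. Qed.
Lemma ReM (a b : R[i]) : complex.Re (a * b) =
  complex.Re a * complex.Re b - complex.Im a * complex.Im b.
Proof. by case: a b => ? ? []. Qed.
Lemma ImM (a b : R[i]) : complex.Im (a * b) =
  complex.Re a * complex.Im b + complex.Im a * complex.Re b.
Proof. by case: a b => ? ? []. Qed.

Lemma C1D O u w : open O -> C1 O u -> C1 O w -> C1 O (fun z => u z + w z).
Proof.
move=> oO [u1 u2] [w1 w2]; split.
  by rewrite (_ : (fun z => _) = fun z => complex.Re (u z) + complex.Re (w z));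
    [exact: C1_realD|apply/funext => z; rewrite ReD].
by rewrite (_ : (fun z => _) = fun z => complex.Im (u z) + complex.Im (w z));
  [exact: C1_realD|apply/funext => z; rewrite ImD].
Qed.

Lemma C1M O u w : open O -> C1 O u -> C1 O w -> C1 O (fun z => u z * w z).
Proof.
move=> oO [u1 u2] [w1 w2]; split.
  rewrite (_ : (fun z => _) = fun z => complex.Re (u z) * complex.Re (w z) +
     - (complex.Im (u z) * complex.Im (w z))); last by apply/funext => z; rewrite ReM.
  exact: (C1_realD oO (C1_realM oO u1 w1) (C1_realN oO (C1_realM oO u2 w2))).
rewrite (_ : (fun z => _) = fun z => complex.Re (u z) * complex.Im (w z) +
     (complex.Im (u z) * complex.Re (w z))); last by apply/funext => z; rewrite ImM.
exact: (C1_realD oO (C1_realM oO u1 w2) (C1_realM oO u2 w1)).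
Qed.

Lemma C1V O u : open O -> (forall z, O z -> u z != 0) -> C1 O u ->
  C1 O (fun z => (u z)^-1).
Proof.
move=> oO u0 [u1 u2].
pose D z := complex.Re (u z) * complex.Re (u z) + complex.Im (u z) * complex.Im (u z).
have D0 z : O z -> D z != 0.
  move=> /u0; apply: contraNneq; rewrite /D -!expr2 => /eqP.
  rewrite paddr_eq0 ?sqr_ge0// !sqrf_eq0 => /andP[a b].
  by rewrite eq_complex /= a b.
have C1D' : C1_real O (fun z => (D z)^-1).
  exact: (C1_realV oO D0 (C1_realD oO (C1_realM oO u1 u1) (C1_realM oO u2 u2))).
split.
  rewrite (_ : (fun z => _) = fun z => complex.Re (u z) * (D z)^-1).
    exact: (C1_realM oO u1 C1D').
  by apply/funext => z; rewrite /D; case: (u z) => a b /=; rewrite !expr2.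
rewrite (_ : (fun z => _) = fun z => - (complex.Im (u z) * (D z)^-1)).
  exact: (C1_realN oO (C1_realM oO u2 C1D')).
by apply/funext => z; rewrite /D; case: (u z) => a b /=; rewrite !expr2.
Qed.

Lemma C1_real_cst O (c : R) : open O -> C1_real O (fun=> c).
Proof.
move=> oO; apply: (@C1_realI O _ (fun=> 0) (fun=> 0) oO).
by move=> z _; split; exact: cvg_cst.
Qed.

Lemma C1_cst O (c : R[i]) : open O -> C1 O (fun=> c).
Proof. by move=> oO; split; exact: C1_real_cst. Qed.

(** Derivability of a complex-valued function along [v], by components. *)
Definition cderivable v u z := derivable (fun z => complex.Re (u z)) z v /\
  derivable (fun z => complex.Im (u z)) z v.

Lemma C1_cderivable O u z : C1 O u -> O z -> cderivable ex u z /\ cderivable ey u z.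
Proof. by move=> [u1 u2] Oz; have [_ [? _] [? _]] := u1 z Oz; have [_ [? _] [? _]] := u2 z Oz. Qed.

Lemma pderivcM v u w z : cderivable v u z -> cderivable v w z ->
  pderivc v (fun z => u z * w z) z = pderivc v u z * w z + u z * pderivc v w z.
Proof.
move=> [/derivableP u1 /derivableP u2] [/derivableP w1 /derivableP w2].
rewrite /pderivc.
rewrite (_ : (fun z => complex.Re (u z * w z)) =
  (fun z => complex.Re (u z)) * (fun z => complex.Re (w z))
  - (fun z => complex.Im (u z)) * (fun z => complex.Im (w z))); last first.
  by apply/funext => t; rewrite ReM.
rewrite (_ : (fun z => complex.Im (u z * w z)) =
  (fun z => complex.Re (u z)) * (fun z => complex.Im (w z))
  + (fun z => complex.Im (u z)) * (fun z => complex.Re (w z))); last first.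
  by apply/funext => t; rewrite ImM.
have [_ ->] := is_deriveB (is_deriveM u1 w1) (is_deriveM u2 w2).
have [_ ->] := is_deriveD (is_deriveM u1 w2) (is_deriveM u2 w1).
apply/eqP; rewrite eq_complex ReD ImD !ReM !ImM /= /GRing.scale /=.
by apply/andP; split; apply/eqP; ring.
Qed.

Lemma pderivcD v u w z : cderivable v u z -> cderivable v w z ->
  pderivc v (fun z => u z + w z) z = pderivc v u z + pderivc v w z.
Proof.
move=> [/derivableP u1 /derivableP u2] [/derivableP w1 /derivableP w2].
rewrite /pderivc.
rewrite (_ : (fun z => complex.Re (u z + w z)) =
  (fun z => complex.Re (u z)) + (fun z => complex.Re (w z))); last first.
  by apply/funext => t; rewrite ReD.
rewrite (_ : (fun z => complex.Im (u z + w z)) =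
  (fun z => complex.Im (u z)) + (fun z => complex.Im (w z))); last first.
  by apply/funext => t; rewrite ImD.
have [_ ->] := is_deriveD u1 w1.
by have [_ ->] := is_deriveD u2 w2.
Qed.

Lemma pderivc_cst v (c : R[i]) z : pderivc v (fun=> c) z = 0.
Proof. by rewrite /pderivc !derive_cst. Qed.

Lemma cderivable_cst v (c : R[i]) z : cderivable v (fun=> c) z.
Proof. by split; exact: derivable_cst. Qed.

Lemma pderivc_near v u w z : (\forall t \near z, u t = w t) ->
  pderivc v u z = pderivc v w z.
Proof.
move=> E; rewrite /pderivc; congr Complex; apply: near_eq_derive => //;
by apply: filterS E => t ->.
Qed.

End C1Calculus.

(** * Moduli of complex numbers and Lipschitz bounds *)

Section ComplexNorm.
Context {R : realType}.
Local Notation nrm := (@ComplexField.Normc.normc R).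
Implicit Types a b : R[i].

Lemma nrmE a : nrm a = Num.sqrt (complex.Re a ^+ 2 + complex.Im a ^+ 2).
Proof. by case: a. Qed.

Lemma nrm_ge0 a : 0 <= nrm a.
Proof. by rewrite nrmE sqrtr_ge0. Qed.

Lemma nrm_sqr a : nrm a ^+ 2 = complex.Re a ^+ 2 + complex.Im a ^+ 2.
Proof. by rewrite nrmE sqr_sqrtr// addr_ge0// sqr_ge0. Qed.

Lemma Re_le_nrm a : `|complex.Re a| <= nrm a.
Proof.
rewrite -(@ler_pXn2r _ 2)// ?nnegrE ?nrm_ge0// nrm_sqr -normrX ger0_norm ?sqr_ge0//.
by rewrite lerDl sqr_ge0.
Qed.

Lemma Im_le_nrm a : `|complex.Im a| <= nrm a.
Proof.
rewrite -(@ler_pXn2r _ 2)// ?nnegrE ?nrm_ge0// nrm_sqr -normrX ger0_norm ?sqr_ge0//.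
by rewrite lerDr sqr_ge0.
Qed.

Lemma nrm_le_ReIm a : nrm a <= `|complex.Re a| + `|complex.Im a|.
Proof.
rewrite -(@ler_pXn2r _ 2)// ?nnegrE ?nrm_ge0 ?addr_ge0// nrm_sqr sqrrD.
rewrite !real_normK ?num_real// -addrA lerD2l lerDr.
by rewrite mulrn_wge0// mulr_ge0.
Qed.

Lemma nrmM a b : nrm (a * b) = nrm a * nrm b.
Proof. exact: ComplexField.Normc.normcM. Qed.

Lemma nrmD a b : nrm (a + b) <= nrm a + nrm b.
Proof. exact: le_normcD. Qed.

Lemma nrmN a : nrm (- a) = nrm a.
Proof. exact: normcN. Qed.

Lemma nrmB a b : nrm (a - b) <= nrm a + nrm b.
Proof. by rewrite -(nrmN b) nrmD. Qed.

Lemma nrm_gt0 a : a != 0 -> 0 < nrm a.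
Proof.
move=> a0; rewrite lt_neqAle nrm_ge0 andbT eq_sym.
by apply: contraNneq a0 => /ComplexField.Normc.eq0_normc ->.
Qed.

Lemma nrmV a : nrm a^-1 = (nrm a)^-1.
Proof. exact: ComplexField.Normc.normcV. Qed.

Lemma nrm_continuous (T : topologicalType) (u : T -> R[i]) (z : T) :
  {for z, continuous (fun z => complex.Re (u z))} ->
  {for z, continuous (fun z => complex.Im (u z))} ->
  {for z, continuous (fun z => nrm (u z))}.
Proof.
move=> cR cI.
rewrite (_ : (fun z => nrm (u z)) =
  Num.sqrt \o (fun z => complex.Re (u z) * complex.Re (u z) +
                        complex.Im (u z) * complex.Im (u z))); last first.
  by apply/funext => t; rewrite nrmE /= !expr2.
apply: continuous_comp; last exact: sqrt_continuous.
exact: (cvgD (cvgM cR cR) (cvgM cI cI)).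
Qed.

End ComplexNorm.

Section PlaneEstimates.
Context {R : realType}.
Local Notation plane := (R * R)%type.
Local Notation nrm := (@ComplexField.Normc.normc R).
Implicit Types (g p q : plane -> R) (u P Q : plane -> R[i]) (z v w : plane).

Lemma C1_real_sub (O O' : set plane) g : O' `<=` O -> C1_real O g -> C1_real O' g.
Proof. by move=> s C1g z /s; exact: C1g. Qed.

Lemma C1_sub (O O' : set plane) u : O' `<=` O -> C1 O u -> C1 O' u.
Proof. by move=> s [u1 u2]; split; exact: C1_real_sub s _. Qed.

(** Lipschitz bound at the centre of a square, by moving along each axis in turn. *)
Lemma lipschitz_center g z (d G : R) : C1_real (ball z d) g ->
  (forall w, ball z d w -> `|'D_ex g w| <= G /\ `|'D_ey g w| <= G) ->
  forall w, ball z d w -> `|g w - g z| <= 2 * G * `|z - w|.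
Proof.
move=> C1g gG w zw.
have zw' : `|z - w| < d by move: zw; rewrite -ball_normE.
pose a := w.1 - z.1; pose b := w.2 - z.2.
have E : z - w = (- a, - b).
  by rewrite /a /b !opprB; case: (z) (w) => ? ? [? ?].
have Ew : w = z + (a, b).
  by rewrite /a /b; case: (z) (w) => ? ? [? ?]; congr pair; rewrite /= addrC subrK.
have na : `|a| <= `|z - w| by rewrite E plane_norm !normrN le_max lexx.
have nb : `|b| <= `|z - w| by rewrite E plane_norm !normrN le_max lexx orbT.
have inb (s t : R) : `|s| <= `|z - w| -> `|t| <= `|z - w| -> ball z d (z + (s, t)).
  move=> sa tb; rewrite -ball_normE /= opprD addNKr normrN plane_norm gt_max.
  by rewrite (le_lt_trans sa)// (le_lt_trans tb).
have inb1 (t : R) : `|t| <= `|a| -> ball z d (z + t *: ex).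
  by move=> ta; rewrite scale_ex; apply: inb; [exact: le_trans na|rewrite normr0].
have inb2 (t : R) : `|t| <= `|b| -> ball z d (z + a *: ex + t *: ey).
  by move=> tb; rewrite planeE; apply: inb => //; exact: le_trans nb.
have [t ta E1] : exists2 t, `|t| <= `|a| & g (z + a *: ex) - g z = a * 'D_ex g (z + t *: ex).
  by apply: MVT_line => t ta; have [_ [? _] _] := C1g _ (inb1 t ta).
have [s sb E2] : exists2 s, `|s| <= `|b| & g (z + a *: ex + b *: ey) - g (z + a *: ex)
    = b * 'D_ey g (z + a *: ex + s *: ey).
  by apply: MVT_line => s sb; have [_ _ [? _]] := C1g _ (inb2 s sb).
have -> : g w - g z = a * 'D_ex g (z + t *: ex) + b * 'D_ey g (z + a *: ex + s *: ey).
  by rewrite -E1 -E2 planeE -Ew; ring.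
have [G1 _] := gG _ (inb1 t ta); have [_ G2] := gG _ (inb2 s sb).
rewrite (le_trans (ler_normD _ _))// !normrM.
rewrite (_ : 2 * G * `|z - w| = `|z - w| * G + `|z - w| * G); last by ring.
by apply: lerD; apply: ler_pM.
Qed.

Lemma clipschitz_center u z (d G : R) : C1 (ball z d) u ->
  (forall w, ball z d w -> nrm (pderivc ex u w) <= G /\ nrm (pderivc ey u w) <= G) ->
  forall w, ball z d w -> nrm (u w - u z) <= 4 * G * `|z - w|.
Proof.
move=> [u1 u2] uG w zw.
rewrite (le_trans (nrm_le_ReIm _))// ReD ReN ImD ImN.
rewrite (_ : 4 * G * `|z - w| = 2 * G * `|z - w| + 2 * G * `|z - w|); last by ring.
apply: lerD.
  apply: (lipschitz_center u1) => // t /uG[h1 h2].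
  by split; [have := le_trans (Re_le_nrm _) h1|have := le_trans (Re_le_nrm _) h2].
apply: (lipschitz_center u2) => // t /uG[h1 h2].
by split; [have := le_trans (Im_le_nrm _) h1|have := le_trans (Im_le_nrm _) h2].
Qed.

(** The same bound for both partial derivatives: [(q, - p)] satisfies the same
    hypotheses as [(p, q)]. *)
Lemma circle_gradient_bound z (r : R) p q (K M S : R) : 0 < r ->
  C1_real (ball z r) p -> C1_real (ball z r) q ->
  (forall w, ball z r w -> [/\ `|'D_ex p w| <= M, `|'D_ey p w| <= M,
      `|'D_ex q w| <= M & `|'D_ey q w| <= M]) ->
  (forall w, ball z r w ->
    `|'D_ex p w - 'D_ey q w| <= K * `|z - w| /\
    `|'D_ey p w + 'D_ex q w| <= K * `|z - w|) ->
  (forall w, ball z r w -> `|p w| + `|q w| <= S) ->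
  `|'D_ex p z| <= 2 * S / r + K * r /\ `|'D_ey p z| <= 2 * S / r + K * r.
Proof.
move=> r0 C1p C1q bM CR bS.
have zr : ball z r z by exact: ballxx.
split; first exact: (circle_mean_bound r0 C1p C1q bM CR bS).
have ob : open (ball z r) by exact: ball_open.
have C1Np : C1_real (ball z r) (fun w => - p w) by exact: C1_realN.
have dN v w : derivable p w v -> 'D_v (fun w => - p w) w = - 'D_v p w.
  by move=> dp; exact: (deriveN dp).
have dp w : ball z r w -> 'D_ex (fun w => - p w) w = - 'D_ex p w /\
     'D_ey (fun w => - p w) w = - 'D_ey p w.
  by move=> /C1p[_ [? _] [? _]]; rewrite !dN.
have -> : `|'D_ey p z| = `|'D_ex q z|.
  have [_] := CR z zr; rewrite subrr normr0 mulr0 normr_le0 addr_eq0 => /eqP ->.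
  by rewrite normrN.
apply: (circle_mean_bound r0 C1q C1Np (M := M)).
- by move=> w zw; have [-> ->] := dp w zw; have [h1 h2 h3 h4] := bM w zw; rewrite !normrN; split.
- move=> w zw; have [-> ->] := dp w zw; have [h1 h2] := CR w zw.
  by split; [rewrite opprK addrC|rewrite distrC].
- by move=> w zw; rewrite normrN addrC; exact: bS.
Qed.

Lemma complex_gradient_bound z (r : R) P Q (K M S : R) : 0 < r ->
  C1 (ball z r) P -> C1 (ball z r) Q ->
  (forall w, ball z r w -> [/\ nrm (pderivc ex P w) <= M, nrm (pderivc ey P w) <= M,
      nrm (pderivc ex Q w) <= M & nrm (pderivc ey Q w) <= M]) ->
  (forall w, ball z r w ->
    nrm (pderivc ex P w - pderivc ey Q w) <= K * `|z - w| /\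
    nrm (pderivc ey P w + pderivc ex Q w) <= K * `|z - w|) ->
  (forall w, ball z r w -> nrm (P w) + nrm (Q w) <= S) ->
  nrm (pderivc ex P z) + nrm (pderivc ey P z) <= 4 * (2 * S / r + K * r).
Proof.
move=> r0 [P1 P2] [Q1 Q2] bM CR bS.
have [h1 h2] : `|'D_ex (fun z => complex.Re (P z)) z| <= 2 * S / r + K * r /\
    `|'D_ey (fun z => complex.Re (P z)) z| <= 2 * S / r + K * r.
  apply: (circle_gradient_bound r0 P1 Q1 (M := M)).
  - move=> w /bM[a b c d]; split; [exact: (le_trans (Re_le_nrm (pderivc ex P w)) a)
      |exact: (le_trans (Re_le_nrm (pderivc ey P w)) b)
      |exact: (le_trans (Re_le_nrm (pderivc ex Q w)) c)
      |exact: (le_trans (Re_le_nrm (pderivc ey Q w)) d)].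
  - move=> w /CR[a b]; split.
      by have := le_trans (Re_le_nrm _) a; rewrite ReD ReN.
    by have := le_trans (Re_le_nrm _) b; rewrite ReD.
  - move=> w wr; exact: (le_trans (lerD (Re_le_nrm (P w)) (Re_le_nrm (Q w))) (bS w wr)).
have [h3 h4] : `|'D_ex (fun z => complex.Im (P z)) z| <= 2 * S / r + K * r /\
    `|'D_ey (fun z => complex.Im (P z)) z| <= 2 * S / r + K * r.
  apply: (circle_gradient_bound r0 P2 Q2 (M := M)).
  - move=> w /bM[a b c d]; split; [exact: (le_trans (Im_le_nrm (pderivc ex P w)) a)
      |exact: (le_trans (Im_le_nrm (pderivc ey P w)) b)
      |exact: (le_trans (Im_le_nrm (pderivc ex Q w)) c)
      |exact: (le_trans (Im_le_nrm (pderivc ey Q w)) d)].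
  - move=> w /CR[a b]; split.
      by have := le_trans (Im_le_nrm _) a; rewrite ImD ImN.
    by have := le_trans (Im_le_nrm _) b; rewrite ImD.
  - move=> w wr; exact: (le_trans (lerD (Im_le_nrm (P w)) (Im_le_nrm (Q w))) (bS w wr)).
have n1 := nrm_le_ReIm (pderivc ex P z); have n2 := nrm_le_ReIm (pderivc ey P z).
rewrite (le_trans (lerD n1 n2))//=.
set X := 2 * S / r + K * r in h1 h2 h3 h4 *.
by rewrite (_ : 4 * X = (X + X) + (X + X)); [exact: (lerD (lerD h1 h3) (lerD h2 h4))|ring].
Qed.

End PlaneEstimates.

(** * The conductivity system *)

Section Conductivity.
Context {R : realType}.
Local Notation plane := (R * R)%type.
Local Notation nrm := (@ComplexField.Normc.normc R).
Implicit Types (f phi psi : plane -> R[i]) (z v w : plane).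

(** The conductivity form of the equation satisfied by [phi = Sc W / f] and
    [psi = f Vec W]. *)
Definition conductivity (O : set plane) f phi psi := forall w, O w ->
  f w ^+ 2 * pderivc ex phi w = pderivc ey psi w /\
  f w ^+ 2 * pderivc ey phi w = - pderivc ex psi w.

(** Freezing the coefficient at the centre: [f z ^+ 2 * phi + j psi] satisfies the
    Cauchy-Riemann system with defect [(f z ^+ 2 - f w ^+ 2) * grad phi], which is
    [O(|w - z|)] because [f] is Lipschitz. *)
Lemma conductivity_gradient_bound z (r : R) f phi psi (b A m S1 S2 : R) :
  0 < r -> 0 <= b ->
  C1 (ball z r) f -> C1 (ball z r) phi -> C1 (ball z r) psi ->
  conductivity (ball z r) f phi psi ->
  (forall w, ball z r w -> nrm (f w) <= 2 * b) -> b / 2 <= nrm (f z) ->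
  (forall w, ball z r w -> nrm (pderivc ex f w) <= A /\ nrm (pderivc ey f w) <= A) ->
  (forall w, ball z r w -> nrm (pderivc ex phi w) <= m /\ nrm (pderivc ey phi w) <= m) ->
  (forall w, ball z r w -> nrm (phi w) <= S1 /\ nrm (psi w) <= S2) ->
  b ^+ 2 / 4 * (nrm (pderivc ex phi z) + nrm (pderivc ey phi z)) <=
    4 * (2 * (4 * b ^+ 2 * S1 + S2) / r + 16 * A * b * m * r).
Proof.
move=> r0 b0 C1f C1phi C1psi sys fb fz fA phim bS.
have ob : open (ball z r) by exact: ball_open.
have zr : ball z r z by exact: ballxx.
pose c := f z ^+ 2.
have nf2 w : ball z r w -> nrm (f w ^+ 2) <= 4 * b ^+ 2.
  move=> /fb h; rewrite expr2 nrmM (_ : 4 * b ^+ 2 = (2 * b) * (2 * b)); last by ring.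
  by apply: ler_pM => //; exact: nrm_ge0.
have C1P : C1 (ball z r) (fun w => c * phi w).
  exact: (C1M ob (C1_cst c ob) C1phi).
have dP w : ball z r w -> pderivc ex (fun w => c * phi w) w = c * pderivc ex phi w /\
    pderivc ey (fun w => c * phi w) w = c * pderivc ey phi w.
  move=> wr; have [d1 d2] := C1_cderivable C1phi wr.
  by rewrite (pderivcM (cderivable_cst ex c w) d1) (pderivcM (cderivable_cst ey c w) d2)
    !pderivc_cst !mul0r !add0r.
have m0 : 0 <= m by have [h _] := phim z zr; exact: le_trans (nrm_ge0 _) h.
have A0 : 0 <= A by have [h _] := fA z zr; exact: le_trans (nrm_ge0 _) h.
have b20 : 0 <= 4 * b ^+ 2 by rewrite mulr_ge0// sqr_ge0.
have cf w : ball z r w -> nrm (c - f w ^+ 2) <= 16 * A * b * `|z - w|.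
  move=> wr; rewrite /c subr_sqr nrmM.
  have h1 : nrm (f z - f w) <= 4 * A * `|z - w|.
    by rewrite -nrmN opprB; exact: (clipschitz_center C1f fA wr).
  have h2 : nrm (f z + f w) <= 2 * b + 2 * b.
    exact: (le_trans (nrmD _ _) (lerD (fb z zr) (fb w wr))).
  rewrite (_ : 16 * A * b * `|z - w| = (4 * A * `|z - w|) * (2 * b + 2 * b)); last by ring.
  by apply: ler_pM => //; exact: nrm_ge0.
have key := @complex_gradient_bound R z r (fun w => c * phi w) psi (16 * A * b * m)
  (4 * b ^+ 2 * m) (4 * b ^+ 2 * S1 + S2) r0 C1P C1psi.
have [dPx dPy] := dP z zr.
rewrite dPx dPy (nrmM c (pderivc ex phi z)) (nrmM c (pderivc ey phi z)) -mulrDr in key.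
apply: le_trans (key _ _ _).
- apply: ler_wpM2r; first by rewrite addr_ge0 ?nrm_ge0.
  rewrite /c (expr2 (f z)) nrmM (_ : b ^+ 2 / 4 = (b / 2) * (b / 2)); last by field.
  by apply: ler_pM => //; exact: divr_ge0.
- move=> w wr; have [-> ->] := dP w wr; have [p1 p2] := phim w wr; have [s1 s2] := sys w wr.
  rewrite -s1 -(nrmN (pderivc ex psi w)) -s2.
  have h1 := nf2 z zr; have h2 := nf2 w wr.
  have aux (a d : R[i]) : nrm a <= 4 * b ^+ 2 -> nrm d <= m ->
      nrm (a * d) <= 4 * b ^+ 2 * m.
    by move=> ha hd; rewrite nrmM; apply: ler_pM => //; exact: nrm_ge0.
  by split; apply: aux.
- move=> w wr; have [-> ->] := dP w wr; have [p1 p2] := phim w wr; have [s1 s2] := sys w wr.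
  have e : 16 * A * b * m * `|z - w| = 16 * A * b * `|z - w| * m by ring.
  rewrite e -s1 -[pderivc ex psi w]opprK -s2 -!mulrBl.
  have aux (a d : R[i]) : nrm a <= 16 * A * b * `|z - w| -> nrm d <= m ->
      nrm (a * d) <= 16 * A * b * `|z - w| * m.
    by move=> ha hd; rewrite nrmM; apply: ler_pM => //; exact: nrm_ge0.
  by split; apply: aux => //; exact: cf.
- move=> w wr; have [s1 s2] := bS w wr; apply: lerD; last exact: s2.
  by rewrite -[leLHS]/(nrm (c * phi w)) nrmM; apply: ler_pM; rewrite ?nrm_ge0//; exact: nf2.
Qed.

End Conductivity.

(** * Absorption of the gradient *)

Section Absorption.
Context {R : realType}.
Local Notation plane := (R * R)%type.
Local Notation nrm := (@ComplexField.Normc.normc R).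
Implicit Types (f phi psi : plane -> R[i]) (z v w : plane).

(** The arithmetic of the absorption: at the radius [r] and the averaging scale [d],
    half of the left-hand side of the hypothesis dominates the terms in [m]. *)
Lemma absorption_algebra (b A m T r d : R) : 0 < b -> 0 < r -> r = 128 * 128 * d ->
  64 * 64 * A * r <= b -> 0 <= m ->
  b ^+ 2 / 4 * m <= 4 * (2 * (4 * b ^+ 2 * (2 / b * T + 16 * m * d) +
     (2 * b * T + 64 * b ^+ 2 * m * d)) / r + 16 * A * b * (4 * m) * r) ->
  b * m * r <= 640 * T.
Proof.
move=> b0 r0 rd rA m0 H.
have rb : 0 <= r / b by rewrite ltW// divr_gt0.
have bn0 : b != 0 by rewrite gt_eqF.
have rn0 : r != 0 by rewrite gt_eqF.
have := ler_wpM2l rb H.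
rewrite (_ : r / b * (b ^+ 2 / 4 * m) = b * m * r / 4); last by field.
rewrite (_ : r / b * (4 * _) = 80 * T + 1024 * b * m * d + 256 * (A * r * (m * r)));
  last by field; rewrite bn0 rn0.
have h1 : 64 * 64 * (A * r * (m * r)) <= b * m * r.
  rewrite (_ : 64 * 64 * _ = 64 * 64 * A * r * (m * r)); last by ring.
  by rewrite -[leRHS]mulrA ler_wpM2r// mulr_ge0// ltW.
have h2 : 1024 * b * m * d = b * m * r / 16 by rewrite rd; field.
rewrite h2; move: h1; set X := b * m * r; set Y := A * r * (m * r); lra.
Qed.

(** Interior bound of the gradient of [phi] by [N], where [N] controls [phi] and
    [psi] at some point of each small square. The constant depends on the size
    of the square and on the bounds for [f] only. *)
Lemma gradient_absorption (R0 b A : R) : 0 < R0 -> 0 < b -> 0 < A ->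
  exists2 C : R, 0 <= C & forall z0 f phi psi (N : R), 0 <= N ->
  C1 (ball z0 (2 * R0)) f -> C1 (ball z0 (2 * R0)) phi -> C1 (ball z0 (2 * R0)) psi ->
  conductivity (ball z0 (2 * R0)) f phi psi ->
  (forall w, ball z0 (2 * R0) w -> b / 2 <= nrm (f w) <= 2 * b) ->
  (forall w, ball z0 (2 * R0) w -> nrm (pderivc ex f w) <= A /\ nrm (pderivc ey f w) <= A) ->
  (forall z d, 0 < d -> ball z d `<=` ball z0 (2 * R0) -> exists2 w, ball z d w &
     nrm (phi w) <= 2 / b * (N / (2 * d)) /\ nrm (psi w) <= 2 * b * (N / (2 * d))) ->
  forall w, ball z0 (R0 / 2) w ->
    nrm (pderivc ex phi w) + nrm (pderivc ey phi w) <= C * N.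
Proof.
move=> R00 b0 A0.
(* The radius will be [tau] times the distance to the boundary: [tau <= 1/4] keeps
   the doubled square at half that distance from the boundary, and the other bound
   makes the term coming from the variation of [f] absorbable. *)
pose tau := Num.min (4^-1) (b / (64 * 64 * A * R0)).
have AR0 : 0 < 64 * 64 * A * R0 by rewrite !mulr_gt0.
have tau0 : 0 < tau by rewrite lt_min invr_gt0 divr_gt0//= ltr0n.
have tau4 : 4 * tau <= 1 by rewrite -ler_pdivlMl// mulr1 ge_min lexx.
have tauA : 64 * 64 * A * R0 * tau <= b by rewrite -ler_pdivlMl// mulrC ge_min lexx orbT.
have [C0 C0E] : exists C0 : R, C0 = 640 * (128 * 64) / (b * tau ^+ 2) by eexists.
have C00 : 0 <= C0.
  have h1 : 0 <= b * tau ^+ 2 := ltW (mulr_gt0 b0 (exprn_gt0 2 tau0)).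
  have h2 : (0 : R) <= 640 * (128 * 64).
    exact: (mulr_ge0 (ler0n _ _) (mulr_ge0 (ler0n _ _) (ler0n _ _))).
  by rewrite C0E; exact: divr_ge0.
exists (4 * C0 / R0 ^+ 2).
  exact: (divr_ge0 (mulr_ge0 (ler0n _ _) C00) (sqr_ge0 R0)).
move=> z0 f phi psi N N0 C1f C1phi C1psi sys fb fA mean.
pose m w := nrm (pderivc ex phi w) + nrm (pderivc ey phi w).
pose dd w : R := R0 - `|z0 - w|.
pose H w := dd w ^+ 2 * m w.
(* [H] is the gradient weighted by the squared distance to the boundary of the
   square [Q]; the estimate is applied at a point [z1] where it is maximal. *)
pose Q : set plane := (`[z0.1 - R0, z0.1 + R0] `*` `[z0.2 - R0, z0.2 + R0])%classic.
have QE w : Q w <-> `|z0 - w| <= R0.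
  case: (z0) (w) @Q => x0 y0 [x y] Q; rewrite /Q /= !in_itv /=.
  have -> : (x0, y0) - (x, y) = (x0 - x, y0 - y) :> plane by [].
  rewrite plane_norm ge_max !ler_norml.
  split.
    by move=> [/andP[? ?] /andP[? ?]]; apply/andP; split; apply/andP; split; lra.
  by move=> /andP[/andP[? ?] /andP[? ?]]; split; apply/andP; split; lra.
have m_ge0 w : 0 <= m w by rewrite addr_ge0 ?nrm_ge0.
have Q2 w : `|z0 - w| <= R0 -> ball z0 (2 * R0) w.
  by move=> h; rewrite -ball_normE /= (le_lt_trans h)// ltr_pMl// ltr1n.
have cQ : compact Q by apply: compact_setX; exact: segment_compact.
have Qz0 : Q z0 by apply/QE; rewrite subrr normr0 ltW.
have cH : {within Q, continuous H}.
  apply: continuous_in_subspaceT => w /set_mem/QE/Q2 wr.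
  have [_ [_ r1] [_ r2]] := C1phi.1 w wr; have [_ [_ i1] [_ i2]] := C1phi.2 w wr.
  have c1 : {for w, continuous (fun w => nrm (pderivc ex phi w))}
    by exact: (nrm_continuous (u := pderivc ex phi) r1 i1).
  have c2 : {for w, continuous (fun w => nrm (pderivc ey phi w))}
    by exact: (nrm_continuous (u := pderivc ey phi) r2 i2).
  have c3 : {for w, continuous dd}.
    apply: cvgB; first exact: cvg_cst.
    by apply: cvg_norm; apply: cvgB; [exact: cvg_cst|exact: cvg_id].
  exact: (cvgM (cvgM c3 c3) (cvgD c1 c2)).
have [z1 /set_mem/QE Qz1 Hmax] := compact_EVT_max (ex_intro _ _ Qz0) cQ cH.
have Hle : H z1 <= C0 * N.
  have d1_ge0 : 0 <= dd z1 by rewrite subr_ge0.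
  have [d10|d1_gt0] := leP (dd z1) 0.
    have d0 : dd z1 = 0 by apply/eqP; rewrite eq_le d10.
    by rewrite /H d0 expr0n mul0r; exact: mulr_ge0.
  (* [d] is the half-side of the squares on which [N] controls [phi] and [psi]. *)
  pose r := tau * dd z1; pose d := r / (128 * 128).
  have r0 : 0 < r by rewrite mulr_gt0.
  have r4 : 4 * r <= dd z1 by rewrite mulrA ler_piMl.
  have k0 : (0 : R) < 128 * 128 by rewrite mulr_gt0 ?ltr0n.
  have d0 : 0 < d by rewrite divr_gt0.
  have rd : r = 128 * 128 * d by rewrite mulrC divfK// gt_eqF.
  have dr : d <= r by rewrite rd; lra.
  have dR : dd z1 <= R0 by rewrite gerBl.
  have rA : 64 * 64 * A * r <= b.
    apply: le_trans tauA.
    have At : 0 <= 64 * 64 * A * tau.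
      exact: (mulr_ge0 (mulr_ge0 (mulr_ge0 (ler0n _ _) (ler0n _ _)) (ltW A0)) (ltW tau0)).
    rewrite /r mulrA (_ : 64 * 64 * A * R0 * tau = 64 * 64 * A * tau * R0); last by ring.
    exact: ler_wpM2l.
  have m1_ge0 : 0 <= m z1 := m_ge0 z1.
  have dist w : `|z1 - w| < 2 * r -> dd z1 / 2 <= dd w.
    move=> zw; have : `|z0 - w| <= `|z0 - z1| + `|z1 - w| by exact: ler_distD.
    by move: r4; rewrite /dd; lra.
  have near2 w : `|z1 - w| < 2 * r -> ball z0 (2 * R0) w.
    by move=> /dist dw; apply: Q2; rewrite -subr_ge0 -/(dd w) (le_trans _ dw)// divr_ge0.
  (* On the square of half-side [2 r] the weight is at least half its value at [z1],
     so that maximality compares the gradients. *)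
  have m4 w : `|z1 - w| < 2 * r -> m w <= 4 * m z1.
    move=> zw; have dw := dist w zw.
    have Qw : Q w by apply/QE; rewrite -subr_ge0 -/(dd w) (le_trans _ dw)// divr_ge0.
    have := Hmax w (mem_set Qw); rewrite /H => hw.
    have : (dd z1 / 2) ^+ 2 * m w <= dd w ^+ 2 * m w.
      apply: ler_wpM2r => //; rewrite ler_pXn2r// nnegrE ?divr_ge0//.
      by rewrite (le_trans _ dw)// divr_ge0.
    move=> /le_trans /(_ hw).
    rewrite (_ : (dd z1 / 2) ^+ 2 * m w = dd z1 ^+ 2 * (m w / 4)); last by field.
    by rewrite ler_pM2l ?exprn_gt0// ler_pdivrMr// mulrC.
  have px w : `|z1 - w| < 2 * r -> nrm (pderivc ex phi w) <= 4 * m z1 /\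
      nrm (pderivc ey phi w) <= 4 * m z1.
    move=> /m4; rewrite /m => h.
    have := nrm_ge0 (pderivc ex phi w); have := nrm_ge0 (pderivc ey phi w).
    move=> h1 h2; split; apply: le_trans h.
      by rewrite lerDl; exact: h1.
    by rewrite lerDr; exact: h2.
  have qx w : `|z1 - w| < 2 * r -> nrm (pderivc ex psi w) <= 16 * b ^+ 2 * m z1 /\
      nrm (pderivc ey psi w) <= 16 * b ^+ 2 * m z1.
    move=> zw; have wr := near2 w zw; have [s1 s2] := sys w wr.
    rewrite -s1 -(nrmN (pderivc ex psi w)) -s2.
    have [p1 p2] := px w zw; have /andP[_ fw] := fb w wr.
    have aux (a : R[i]) : nrm a <= 4 * m z1 -> nrm (f w ^+ 2 * a) <= 16 * b ^+ 2 * m z1.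
      move=> ha; rewrite nrmM (expr2 (f w)) nrmM.
      rewrite (_ : 16 * b ^+ 2 * m z1 = 2 * b * (2 * b) * (4 * m z1)); last by ring.
      apply: ler_pM => //; rewrite ?nrm_ge0 ?mulr_ge0 ?nrm_ge0//.
      by apply: ler_pM; rewrite ?nrm_ge0.
    by split; exact: aux.
  have in2 w w' : ball z1 r w -> ball w d w' -> `|z1 - w'| < 2 * r.
    rewrite -!ball_normE /= => h1 h2; have := ler_distD w z1 w'; lra.
  pose T := N / (2 * d).
  have val w : ball z1 r w -> nrm (phi w) <= 2 / b * T + 16 * m z1 * d /\
      nrm (psi w) <= 2 * b * T + 64 * b ^+ 2 * m z1 * d.
    move=> zw.
    have sub : ball w d `<=` ball z0 (2 * R0) by move=> w' /(in2 _ _ zw)/near2.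
    have [w' ww' [m1 m2]] := mean w d d0 sub.
    have dw' : `|w - w'| <= d by move: ww'; rewrite -ball_normE /= => /ltW.
    have L1 : nrm (phi w' - phi w) <= 4 * (4 * m z1) * `|w - w'|.
      by apply: (clipschitz_center (C1_sub sub C1phi)) => // t /(in2 _ _ zw)/px.
    have L2 : nrm (psi w' - psi w) <= 4 * (16 * b ^+ 2 * m z1) * `|w - w'|.
      by apply: (clipschitz_center (C1_sub sub C1psi)) => // t /(in2 _ _ zw)/qx.
    have e1 : 4 * (4 * m z1) * `|w - w'| <= 16 * m z1 * d.
      rewrite (_ : 4 * (4 * m z1) = 16 * m z1); last by ring.
      exact: (ler_wpM2l (mulr_ge0 (ler0n _ _) m1_ge0) dw').
    have e2 : 4 * (16 * b ^+ 2 * m z1) * `|w - w'| <= 64 * b ^+ 2 * m z1 * d.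
      rewrite (_ : 4 * (16 * b ^+ 2 * m z1) = 64 * b ^+ 2 * m z1); last by ring.
      exact: (ler_wpM2l (mulr_ge0 (mulr_ge0 (ler0n _ _) (sqr_ge0 b)) m1_ge0) dw').
    split.
      rewrite -[phi w](subKr (phi w')) (le_trans (nrmB _ _))//.
      exact: (lerD m1 (le_trans L1 e1)).
    rewrite -[psi w](subKr (psi w')) (le_trans (nrmB _ _))//.
    exact: (lerD m2 (le_trans L2 e2)).
  have sub1 : ball z1 r `<=` ball z0 (2 * R0).
    move=> w wr; apply: near2; move: wr; rewrite -ball_normE /= => h; lra.
  have zr w : ball z1 r w -> `|z1 - w| < 2 * r by rewrite -ball_normE /= => h; lra.
  have /andP[fz1 _] := fb z1 (Q2 z1 Qz1).
  have key := @conductivity_gradient_bound R z1 r f phi psi b A (4 * m z1)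
     (2 / b * T + 16 * m z1 * d) (2 * b * T + 64 * b ^+ 2 * m z1 * d) r0 (ltW b0)
     (C1_sub sub1 C1f) (C1_sub sub1 C1phi) (C1_sub sub1 C1psi)
     (fun w h => sys w (sub1 w h)) (fun w h => proj2 (andP (fb w (sub1 w h)))) fz1
     (fun w h => fA w (sub1 w h)) (fun w h => px w (zr w h)) val.
  have := absorption_algebra b0 r0 rd rA m1_ge0 key.
  have -> : 640 * T = 640 * (128 * 64) * N / r.
    by rewrite /T rd; field; rewrite gt_eqF.
  rewrite ler_pdivlMr// => fin.
  rewrite C0E mulrAC ler_pdivlMr; last exact: mulr_gt0 b0 (exprn_gt0 2 tau0).
  apply: le_trans fin; rewrite /H /r le_eqVlt; apply/orP; left; apply/eqP; ring.
move=> w; rewrite -ball_normE /= => wr.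
have dw : R0 / 2 <= dd w by rewrite /dd; lra.
have Qw : Q w by apply/QE; lra.
have := le_trans (Hmax w (mem_set Qw)) Hle; rewrite /H => hw.
have hm : (R0 / 2) ^+ 2 * m w <= C0 * N.
  apply: le_trans hw; apply: ler_wpM2r => //; rewrite ler_pXn2r// nnegrE; lra.
rewrite -/(m w) (_ : 4 * C0 / R0 ^+ 2 * N = 4 * (C0 * N) / R0 ^+ 2); last by ring.
rewrite ler_pdivlMr; last exact: exprn_gt0.
rewrite (_ : m w * R0 ^+ 2 = 4 * ((R0 / 2) ^+ 2 * m w)); last by field.
by rewrite ler_pM2l// ltr0n.
Qed.

End Absorption.

(** * Reduction of the Vekua equation to the conductivity system *)

Section Vekua.
Context {R : realType}.
Local Notation plane := (R * R)%type.
Local Notation nrm := (@ComplexField.Normc.normc R).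
Local Notation B := (bicomplex R).
Implicit Types (f u v : plane -> R[i]) (z w : plane) (W : plane -> B) (Omega : set plane).

Local Notation SW W := (fun z => Sc (W z)).
Local Notation VW W := (fun z => Vec (W z)).

Lemma bicomplex_eq (x y : B) : Sc x = Sc y -> Vec x = Vec y -> x = y.
Proof. by case: x => a b; case: y => c d /= -> ->. Qed.

(** The two complex components of the equation, multiplied by [2 f]. *)
Definition vekua_at f W z :=
  f z * (pderivc ex (SW W) z - pderivc ey (VW W) z) =
    pderivc ex f z * Sc (W z) + pderivc ey f z * Vec (W z) /\
  f z * (pderivc ey (SW W) z + pderivc ex (VW W) z) =
    pderivc ey f z * Sc (W z) - pderivc ex f z * Vec (W z).

Lemma ScM (x y : B) : Sc (x * y) = Sc x * Sc y - Vec x * Vec y.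
Proof. by []. Qed.
Lemma VecM (x y : B) : Vec (x * y) = Sc x * Vec y + Vec x * Sc y.
Proof. by []. Qed.
Lemma ScD (x y : B) : Sc (x + y) = Sc x + Sc y.
Proof. by []. Qed.
Lemma VecD (x y : B) : Vec (x + y) = Vec x + Vec y.
Proof. by []. Qed.
Lemma ScZ a (x : B) : Sc (a *: x) = a * Sc x.
Proof. by []. Qed.
Lemma VecZ a (x : B) : Vec (a *: x) = a * Vec x.
Proof. by []. Qed.

Lemma vekuaP f W z : f z != 0 ->
  dbar W z = ((f z)^-1 *: dbar (fun t => (f t)%:A) z) * conjb (W z) <-> vekua_at f W z.
Proof.
move=> f0; have n2 : (2 : R[i]) != 0 by rewrite pnatr_eq0.
have Ef : SW (fun t => (f t)%:A : B) = f.
  by apply/funext => t; rewrite ScZ /= mulr1.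
have E0 : VW (fun t => (f t)%:A : B) = fun=> 0.
  by apply/funext => t; rewrite VecZ /= mulr0.
have Es : Sc (dbar W z) = 2^-1 * (pderivc ex (SW W) z - pderivc ey (VW W) z).
  by rewrite /dbar ScZ ScD ScM /= mul0r mul1r sub0r.
have Ev : Vec (dbar W z) = 2^-1 * (pderivc ey (SW W) z + pderivc ex (VW W) z).
  by rewrite /dbar VecZ VecD VecM /= mul0r mul1r add0r addrC.
have Efs : Sc (dbar (fun t => (f t)%:A : B) z) = 2^-1 * pderivc ex f z.
  by rewrite /dbar ScZ ScD ScM /= Ef E0 !pderivc_cst mul0r mulr0 subr0 addr0.
have Efv : Vec (dbar (fun t => (f t)%:A : B) z) = 2^-1 * pderivc ey f z.
  by rewrite /dbar VecZ VecD VecM /= Ef E0 !pderivc_cst mul0r mul1r !add0r.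
pose fx := pderivc ex f z; pose fy := pderivc ey f z.
pose RHS := ((f z)^-1 *: dbar (fun t => (f t)%:A : B) z) * conjb (W z).
have ES : Sc RHS = (2 * f z)^-1 * (fx * Sc (W z) + fy * Vec (W z)).
  rewrite /RHS ScM ScZ VecZ Efs Efv -/fx -/fy invfM.
  by rewrite -[Sc (conjb _)]/(Sc (W z)) -[Vec (conjb _)]/(- Vec (W z)); ring.
have EV : Vec RHS = (2 * f z)^-1 * (fy * Sc (W z) - fx * Vec (W z)).
  rewrite /RHS VecM ScZ VecZ Efs Efv -/fx -/fy invfM.
  by rewrite -[Sc (conjb _)]/(Sc (W z)) -[Vec (conjb _)]/(- Vec (W z)); ring.
have n2f : 2 * f z != 0 by rewrite mulf_neq0.
have aux (x y : R[i]) : 2^-1 * x = (2 * f z)^-1 * y <-> f z * x = y.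
  split=> [h|<-]; last by field; rewrite ?n2 ?f0.
  have -> : f z * x = (2 * f z) * (2^-1 * x) by field.
  by rewrite h mulrA divff// mul1r.
rewrite -/RHS /vekua_at; split=> [h|[h1 h2]].
  by split; apply/aux; [rewrite -ES -h Es|rewrite -EV -h Ev].
by apply: bicomplex_eq; [rewrite Es ES; exact/aux|rewrite Ev EV; exact/aux].
Qed.

(** Passing from [W = u + j v] to [phi = u / f] and [psi = f v]. *)
Lemma vekua_conductivity Omega f W : open Omega -> C1 Omega f ->
  (forall z, Omega z -> f z != 0) -> C1b Omega W ->
  (forall z, Omega z -> vekua_at f W z) ->
  conductivity Omega f (fun z => Sc (W z) * (f z)^-1) (fun z => f z * Vec (W z)).
Proof.
move=> oO C1f f0 [C1u C1v] eqW w Ow.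
have fw := f0 w Ow.
have C1phi := C1M oO C1u (C1V oO f0 C1f).
have [px py] := C1_cderivable C1phi Ow; have [fx fy] := C1_cderivable C1f Ow.
have [ux uy] := C1_cderivable C1u Ow; have [vx vy] := C1_cderivable C1v Ow.
have nO : \forall t \near w, Sc (W t) = (Sc (W t) * (f t)^-1) * f t.
  have : nbhs w Omega by exact: open_nbhs_nbhs.
  by apply: filterS => t /f0 ft; rewrite mulfVK.
have Ex : pderivc ex (SW W) w = pderivc ex (fun z => Sc (W z) * (f z)^-1) w * f w +
    (Sc (W w) * (f w)^-1) * pderivc ex f w.
  by rewrite (pderivc_near ex nO) (pderivcM px fx).
have Ey : pderivc ey (SW W) w = pderivc ey (fun z => Sc (W z) * (f z)^-1) w * f w +
    (Sc (W w) * (f w)^-1) * pderivc ey f w.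
  by rewrite (pderivc_near ey nO) (pderivcM py fy).
have [e1 e2] := eqW w Ow.
rewrite (pderivcM fx vx) (pderivcM fy vy).
set X := pderivc ex (fun z => Sc (W z) * (f z)^-1) w in Ex *.
set Y := pderivc ey (fun z => Sc (W z) * (f z)^-1) w in Ey *.
have Xe : f w ^+ 2 * X = f w * pderivc ex (SW W) w - Sc (W w) * pderivc ex f w.
  by rewrite Ex; field.
have Ye : f w ^+ 2 * Y = f w * pderivc ey (SW W) w - Sc (W w) * pderivc ey f w.
  by rewrite Ey; field.
split.
  rewrite Xe; apply/eqP; rewrite -subr_eq0; apply/eqP.
  by move/eqP: e1; rewrite -subr_eq0 => /eqP <-; ring.
rewrite Ye; apply/eqP; rewrite -subr_eq0; apply/eqP.
by move/eqP: e2; rewrite -subr_eq0 => /eqP <-; ring.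
Qed.

End Vekua.

(** * The interior estimate *)

Section InteriorEstimate.
Context {R : realType}.
Local Notation plane := (R * R)%type.
Local Notation nrm := (@ComplexField.Normc.normc R).
Local Notation B := (bicomplex R).
Implicit Types (f u v : plane -> R[i]) (z w : plane) (W : plane -> B) (Omega : set plane).

Local Notation SW W := (fun z => Sc (W z)).
Local Notation VW W := (fun z => Vec (W z)).

Lemma local_bounds Omega f z0 : open Omega -> C1 Omega f ->
  Omega z0 -> f z0 != 0 ->
  exists r b A : R, [/\ 0 < r, 0 < b, 0 < A, ball z0 (2 * r) `<=` Omega &
    forall w, ball z0 (2 * r) w -> [/\ b / 2 <= nrm (f w) <= 2 * b,
      nrm (pderivc ex f w) <= A & nrm (pderivc ey f w) <= A]].
Proof.
move=> oO [C1r C1i] Oz f0.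
have [cr [_ rx] [_ ry]] := C1r z0 Oz; have [ci [_ ix] [_ iy]] := C1i z0 Oz.
have c0 : {for z0, continuous (fun w => nrm (f w))} := nrm_continuous (u := f) cr ci.
have cx : {for z0, continuous (fun w => nrm (pderivc ex f w))}
  := nrm_continuous (u := pderivc ex f) rx ix.
have cy : {for z0, continuous (fun w => nrm (pderivc ey f w))}
  := nrm_continuous (u := pderivc ey f) ry iy.
pose b := nrm (f z0).
pose A := nrm (pderivc ex f z0) + nrm (pderivc ey f z0) + 1.
have b0 : 0 < b by exact: nrm_gt0.
have xA : nrm (pderivc ex f z0) < A by rewrite /A -addrA ltrDl ltr_wpDl ?ltr01 ?nrm_ge0.
have yA : nrm (pderivc ey f z0) < A by rewrite /A addrAC ltrDr ltr_wpDl ?ltr01 ?nrm_ge0.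
have A0 : 0 < A by exact: le_lt_trans (nrm_ge0 _) xA.
have bl : b / 2 < nrm (f z0) by rewrite -/b ltr_pdivrMr// ltr_pMr// ltr1n.
have br : nrm (f z0) < 2 * b by rewrite -/b ltr_pMl// ltr1n.
have n1 : \forall t \near z0, b / 2 < nrm (f t) by exact: (cvgr_gt _ c0 _ bl).
have n2 : \forall t \near z0, nrm (f t) < 2 * b by exact: (cvgr_lt _ c0 _ br).
have n3 : \forall t \near z0, nrm (pderivc ex f t) < A by exact: (cvgr_lt _ cx _ xA).
have n4 : \forall t \near z0, nrm (pderivc ey f t) < A by exact: (cvgr_lt _ cy _ yA).
have nO : nbhs z0 Omega by exact: open_nbhs_nbhs.
have /nbhs_ballP[r /= r0 Hr] : \forall w \near z0, Omega w /\
    ((b / 2 < nrm (f w) /\ nrm (f w) < 2 * b) /\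
     (nrm (pderivc ex f w) < A /\ nrm (pderivc ey f w) < A)).
  exact: (filterI nO (filterI (filterI n1 n2) (filterI n3 n4))).
exists (r / 2), b, A; rewrite [2 * (r / 2)]mulrC divfK; last by rewrite pnatr_eq0.
split=> //; first exact: divr_gt0.
  by move=> w /Hr[].
move=> w /Hr[_ [[h1 h2] [h3 h4]]].
by split; [apply/andP; split; exact: ltW|exact: ltW|exact: ltW].
Qed.

Lemma le_sum4 (x y s t : R) : 0 <= x -> 0 <= y -> 0 <= s -> 0 <= t ->
  [/\ x <= x + y + s + t, y <= x + y + s + t, s <= x + y + s + t & t <= x + y + s + t].
Proof. by move=> x0 y0 s0 t0; split; lra. Qed.

(** [N] controls [W] at some point of every square inside [Omega], as the norm
    of [W] in [L2] does. *)
Definition square_mean_le Omega W (N : R) := forall z d, 0 < d -> ball z d `<=` Omega ->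
  exists2 w, ball z d w & nrm (Sc (W w)) <= N / (2 * d) /\ nrm (Vec (W w)) <= N / (2 * d).

(** The values and the first derivatives of a solution are bounded, near each
    point and uniformly in the solution, by any [N] as in [square_mean_le]. *)
Lemma interior_estimate Omega f z0 : open Omega -> C1 Omega f ->
  (forall z, Omega z -> f z != 0) -> Omega z0 ->
  exists r C : R, [/\ 0 < r, 0 <= C, ball z0 r `<=` Omega &
   forall W (N : R), 0 <= N -> C1b Omega W -> (forall z, Omega z -> vekua_at f W z) ->
     square_mean_le Omega W N ->
   forall w, ball z0 r w ->
   [/\ nrm (Sc (W w)) <= C * N, nrm (Vec (W w)) <= C * N,
       nrm (pderivc ex (SW W) w) <= C * N /\ nrm (pderivc ey (SW W) w) <= C * N &
       nrm (pderivc ex (VW W) w) <= C * N /\ nrm (pderivc ey (VW W) w) <= C * N]].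
Proof.
move=> oO C1f f0 Oz0.
have [r [b [A [r0 b0 A0 rO fb]]]] := local_bounds oO C1f Oz0 (f0 z0 Oz0).
have [C C0 HC] := gradient_absorption r0 b0 A0.
(* Bounds for [phi], [psi], and then for [v], [u] and their derivatives. *)
pose d := r / 4.
have d0 : 0 < d by exact: divr_gt0.
pose Cp := 2 / b / (2 * d) + 4 * C * d.
pose Cq := 2 * b / (2 * d) + 4 * (4 * b ^+ 2 * C) * d.
pose Cv := Cq * (2 / b).
pose Cu := Cp * (2 * b).
pose Cux := C * (2 * b) + Cp * A.
pose Cvx := (2 / b) * (4 * b ^+ 2 * C + A * Cv).
have b20 : 0 <= 2 / b by exact: divr_ge0 (ltW b0).
have bb0 : 0 <= 2 * b by exact: mulr_ge0 (ltW b0).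
have bC0 : 0 <= 4 * b ^+ 2 * C by exact: mulr_ge0 (mulr_ge0 (ler0n _ _) (sqr_ge0 b)) C0.
have dd0 : 0 <= 2 * d by exact: mulr_ge0 (ltW d0).
have Cp0 : 0 <= Cp.
  exact: (addr_ge0 (divr_ge0 b20 dd0) (mulr_ge0 (mulr_ge0 (ler0n _ _) C0) (ltW d0))).
have Cq0 : 0 <= Cq.
  exact: (addr_ge0 (divr_ge0 bb0 dd0) (mulr_ge0 (mulr_ge0 (ler0n _ _) bC0) (ltW d0))).
have Cv0 : 0 <= Cv by exact: mulr_ge0.
have Cu0 : 0 <= Cu by exact: mulr_ge0.
have Cux0 : 0 <= Cux by exact: (addr_ge0 (mulr_ge0 C0 bb0) (mulr_ge0 Cp0 (ltW A0))).
have Cvx0 : 0 <= Cvx by exact: (mulr_ge0 b20 (addr_ge0 bC0 (mulr_ge0 (ltW A0) Cv0))).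
exists d, (Cu + Cv + Cux + Cvx); split=> //.
- exact: (addr_ge0 (addr_ge0 (addr_ge0 Cu0 Cv0) Cux0) Cvx0).
- move=> w wd; apply: rO; move: wd; rewrite -ball_normE /= /d => h; lra.
move=> W N N0 C1W eqW meanW.
pose phi z := Sc (W z) * (f z)^-1; pose psi z := f z * Vec (W z).
have C1phi : C1 Omega phi := C1M oO C1W.1 (C1V oO f0 C1f).
have C1psi : C1 Omega psi := C1M oO C1f C1W.2.
have sys := vekua_conductivity oO C1f f0 C1W eqW.
have nf w : ball z0 (2 * r) w -> nrm (f w) <= 2 * b by move=> /fb[/andP[]].
have nfV w : ball z0 (2 * r) w -> (nrm (f w))^-1 <= 2 / b.
  move=> wr; have [/andP[h _] _ _] := fb w wr.
  have b2 : 0 < b / 2 by exact: divr_gt0.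
  by rewrite -[2 / b]invf_div lef_pV2// posrE (lt_le_trans b2 h).
have mean z e : 0 < e -> ball z e `<=` ball z0 (2 * r) -> exists2 w, ball z e w &
     nrm (phi w) <= 2 / b * (N / (2 * e)) /\ nrm (psi w) <= 2 * b * (N / (2 * e)).
  move=> e0 sub; have [w zw [h1 h2]] := meanW z e e0 (subset_trans sub rO).
  have wr := sub w zw; exists w => //; split.
    rewrite /phi mulrC nrmM nrmV; apply: ler_pM; rewrite ?nrm_ge0//; last exact: nfV.
    by rewrite invr_ge0 nrm_ge0.
  by rewrite /psi nrmM; apply: ler_pM; rewrite ?nrm_ge0//; exact: nf.
have grad : forall w, ball z0 (r / 2) w ->
    nrm (pderivc ex phi w) + nrm (pderivc ey phi w) <= C * N.
  apply: (HC z0 f phi psi N N0 (C1_sub rO C1f) (C1_sub rO C1phi) (C1_sub rO C1psi)) => //.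
  - by move=> w /rO; exact: sys.
  - by move=> w /fb[].
  - by move=> w /fb[].
have half w : ball z0 (r / 2) w -> ball z0 (2 * r) w.
  by rewrite -ball_normE /= => h; lra.
have gphi w : ball z0 (r / 2) w ->
    nrm (pderivc ex phi w) <= C * N /\ nrm (pderivc ey phi w) <= C * N.
  move=> /grad h; split; apply: le_trans h.
    by rewrite lerDl; exact: nrm_ge0.
  by rewrite lerDr; exact: nrm_ge0.
have gpsi w : ball z0 (r / 2) w ->
    nrm (pderivc ex psi w) <= 4 * b ^+ 2 * C * N /\ nrm (pderivc ey psi w) <= 4 * b ^+ 2 * C * N.
  move=> wr; have [s1 s2] := sys w (rO w (half w wr)).
  rewrite -s1 -(nrmN (pderivc ex psi w)) -s2; have [p1 p2] := gphi w wr.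
  have fw := nf w (half w wr).
  have aux (a : R[i]) : nrm a <= C * N -> nrm (f w ^+ 2 * a) <= 4 * b ^+ 2 * C * N.
    move=> ha; rewrite nrmM (expr2 (f w)) nrmM.
    rewrite (_ : 4 * b ^+ 2 * C * N = 2 * b * (2 * b) * (C * N)); last by ring.
    apply: ler_pM => //; first exact: mulr_ge0 (nrm_ge0 _) (nrm_ge0 _).
      exact: nrm_ge0.
    by apply: ler_pM => //; exact: nrm_ge0.
  by split; [exact: (aux _ p2)|exact: (aux _ p1)].
move=> w wd.
have wh : ball z0 (r / 2) w by move: wd; rewrite -ball_normE /= /d => h; lra.
have w2 := half w wh.
have sub w' : ball w d w' -> ball z0 (r / 2) w'.
  move: wd; rewrite -!ball_normE /= /d => h1 h2; have := ler_distD w z0 w'; lra.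
have [w' ww' [m1 m2]] := mean w d d0 (fun t h => half t (sub t h)).
have dw' : `|w - w'| <= d by move: ww'; rewrite -ball_normE /= => /ltW.
have subO : ball w d `<=` Omega by move=> t /sub/half/rO.
have L1 : nrm (phi w' - phi w) <= 4 * (C * N) * `|w - w'|.
  by apply: (clipschitz_center (C1_sub subO C1phi)) => // t /sub; exact: gphi.
have L2 : nrm (psi w' - psi w) <= 4 * (4 * b ^+ 2 * C * N) * `|w - w'|.
  by apply: (clipschitz_center (C1_sub subO C1psi)) => // t /sub; exact: gpsi.
have bphi : nrm (phi w) <= Cp * N.
  rewrite -[phi w](subKr (phi w')) (le_trans (nrmB _ _))//.
  rewrite (_ : Cp * N = 2 / b * (N / (2 * d)) + 4 * (C * N) * d); last by rewrite /Cp; ring.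
  apply: (lerD m1 (le_trans L1 _)).
  exact: (ler_wpM2l (mulr_ge0 (ler0n _ _) (mulr_ge0 C0 N0)) dw').
have bpsi : nrm (psi w) <= Cq * N.
  rewrite -[psi w](subKr (psi w')) (le_trans (nrmB _ _))//.
  rewrite (_ : Cq * N = 2 * b * (N / (2 * d)) + 4 * (4 * b ^+ 2 * C * N) * d);
    last by rewrite /Cq; ring.
  apply: (lerD m2 (le_trans L2 _)).
  exact: (ler_wpM2l (mulr_ge0 (ler0n _ _) (mulr_ge0 bC0 N0)) dw').
have Ow := rO w w2; have fw := f0 w Ow.
have [px py] := gphi w wh; have [qx qy] := gpsi w wh.
have [_ fx fy] := fb w w2.
have Eu t : Omega t -> Sc (W t) = phi t * f t by move=> Ot; rewrite /phi mulfVK//; exact: f0.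
have bu : nrm (Sc (W w)) <= Cu * N.
  rewrite (Eu w Ow) nrmM (_ : Cu * N = Cp * N * (2 * b)); last by rewrite /Cu; ring.
  exact: (ler_pM (nrm_ge0 _) (nrm_ge0 _) bphi (nf w w2)).
have bv : nrm (Vec (W w)) <= Cv * N.
  rewrite (_ : Vec (W w) = psi w * (f w)^-1); last by rewrite /psi mulrAC divff// mul1r.
  rewrite nrmM nrmV (_ : Cv * N = Cq * N * (2 / b)); last by rewrite /Cv; ring.
  have i0 : 0 <= (nrm (f w))^-1 by rewrite invr_ge0 nrm_ge0.
  exact: (ler_pM (nrm_ge0 _) i0 bpsi (nfV w w2)).
have nO : \forall t \near w, Sc (W t) = phi t * f t.
  have : nbhs w Omega by exact: open_nbhs_nbhs.
  by apply: filterS => t; exact: Eu.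
have [dpx dpy] := C1_cderivable C1phi Ow; have [dfx dfy] := C1_cderivable C1f Ow.
have [dvx dvy] := C1_cderivable C1W.2 Ow.
have bux (a c : R[i]) : nrm a <= C * N -> nrm c <= A ->
    nrm (a * f w + phi w * c) <= Cux * N.
  move=> ha hc; apply: (le_trans (nrmD _ _)); rewrite (nrmM a (f w)) (nrmM (phi w) c).
  rewrite (_ : Cux * N = C * N * (2 * b) + Cp * N * A); last by rewrite /Cux; ring.
  exact: (lerD (ler_pM (nrm_ge0 _) (nrm_ge0 _) ha (nf w w2))
    (ler_pM (nrm_ge0 _) (nrm_ge0 _) bphi hc)).
have bvx (a c e : R[i]) : nrm a <= 4 * b ^+ 2 * C * N -> nrm c <= A ->
    a = c * Vec (W w) + f w * e -> nrm e <= Cvx * N.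
  move=> ha hc ae.
  have -> : e = (f w)^-1 * (a - c * Vec (W w)) by rewrite ae; field.
  rewrite nrmM nrmV (_ : Cvx * N = 2 / b * (4 * b ^+ 2 * C * N + A * (Cv * N)));
    last by rewrite /Cvx; ring.
  have i0 : 0 <= (nrm (f w))^-1 by rewrite invr_ge0 nrm_ge0.
  apply: (ler_pM i0 (nrm_ge0 _) (nfV w w2)).
  apply: (le_trans (nrmB _ _)); rewrite nrmM.
  exact: (lerD ha (ler_pM (nrm_ge0 _) (nrm_ge0 _) hc bv)).
have CN (c c' : R) : c <= c' -> c * N <= c' * N by move=> ?; exact: ler_wpM2r.
have [cu cv cux cvx] := le_sum4 Cu0 Cv0 Cux0 Cvx0.
split; [exact: (le_trans bu (CN _ _ cu))|exact: (le_trans bv (CN _ _ cv))| |].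
- split; apply: (le_trans _ (CN _ _ cux)).
    by rewrite (pderivc_near ex nO) (pderivcM dpx dfx); exact: bux.
  by rewrite (pderivc_near ey nO) (pderivcM dpy dfy); exact: bux.
- split; apply: (le_trans _ (CN _ _ cvx)).
    by apply: (bvx _ _ _ qx fx); rewrite (pderivcM dfx dvx).
  by apply: (bvx _ _ _ qy fy); rewrite (pderivcM dfy dvy).
Qed.

End InteriorEstimate.

(** * Area measure and open sets *)

Section Area.
Context {R : realType}.
Local Notation plane := (R * R)%type.
Local Notation mplane := (measurableTypeR R * measurableTypeR R)%type.
Local Notation area := (@lebesgue_measure R \x @lebesgue_measure R)%E.
Implicit Types (z w : plane) (Omega : set plane).

Lemma square_ball z (d : R) :
  ball z d = (`]z.1 - d, z.1 + d[ `*` `]z.2 - d, z.2 + d[)%classic.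
Proof.
case: z => x y; apply/seteqP; split => -[a b]; rewrite -ball_normE /=.
  have -> : (x, y) - (a, b) = (x - a, y - b) :> plane by [].
  rewrite plane_norm gt_max !ltr_norml !in_itv /=.
  by move=> /andP[/andP[? ?] /andP[? ?]]; split; apply/andP; split; lra.
rewrite !in_itv /= => -[/andP[? ?] /andP[? ?]].
have -> : (x, y) - (a, b) = (x - a, y - b) :> plane by [].
rewrite plane_norm gt_max !ltr_norml.
by apply/andP; split; apply/andP; split; lra.
Qed.

Lemma measurable_square z (d : R) : measurable (ball z d : set mplane).
Proof. by rewrite square_ball; apply: measurableX; exact: measurable_itv. Qed.

Lemma area_square z (d : R) : 0 < d -> area (ball z d) = (4 * d ^+ 2)%:E.
Proof.
move=> d0; have E (x : R) :
    lebesgue_measure (`]x - d, x + d[%classic : set (measurableTypeR R)) = (2 * d)%:E.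
  rewrite lebesgue_measure_itv /= lte_fin ifT; last by move: d0; lra.
  by rewrite -EFinB; congr EFin; ring.
rewrite square_ball product_measure1E; [|exact: measurable_itv..].
by rewrite [X in (X * _)%E]E [X in (_ * X)%E]E -EFinM; congr EFin; ring.
Qed.

(** An open set is the union of the squares with rational centre and half-side
    that it contains. *)
Lemma open_plane_measurable Omega : open Omega -> measurable (Omega : set mplane).
Proof.
move=> oO.
pose c (q : rat * rat * rat) : plane := (ratr q.1.1, ratr q.1.2).
pose F (q : rat * rat * rat) : set mplane :=
  if `[< ball (c q) (ratr q.2) `<=` Omega >] then ball (c q) (ratr q.2) else set0.
have -> : Omega = \bigcup_q F q.
  apply/seteqP; split => [z Oz|z [q _]]; last first.
    by rewrite /F; case: ifP => // /asboolP; apply.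
  have /nbhs_ballP[e /= e0 He] : nbhs z Omega by exact: open_nbhs_nbhs.
  have e30 : 0 < e / 3 by exact: divr_gt0.
  have rat_near (t : R) : exists q : rat, `|t - ratr q| < e / 3.
    have tt : t < t + e / 3 by rewrite ltrDl.
    have [q] := rat_in_itvoo tt; rewrite in_itv /= => /andP[h1 h2]; exists q.
    by rewrite distrC gtr0_norm ?subr_gt0// ltrBlDl.
  have [x hx] := rat_near z.1; have [y hy] := rat_near z.2.
  have e32 : e / 3 < e / 2 by rewrite ltr_pM2l// ltf_pV2 ?posrE// ltr_nat.
  have [rho] := rat_in_itvoo e32; rewrite in_itv /= => /andP[h1 h2].
  have zc : `|(ratr x, ratr y) - z| < e / 3.
    case: (z) hx hy => z1 z2 /= hx hy.
    rewrite (_ : (ratr x, ratr y) - (z1, z2) = (ratr x - z1, ratr y - z2) :> plane)//.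
    by rewrite plane_norm gt_max distrC hx distrC hy.
  exists (x, y, rho) => //; rewrite /F ifT /=.
    by rewrite -ball_normE /=; exact: lt_trans h1.
  apply/asboolP => w; rewrite /c -ball_normE /= => cw; apply: He.
  rewrite -ball_normE /= (le_lt_trans (ler_distD (ratr x, ratr y) z w))//.
  rewrite [e in _ < e](splitr e) ltrD//; last exact: lt_trans h2.
  by rewrite distrC (lt_trans zc).
apply: countable_bigcupT_measurable; first exact: countableP.
by move=> q; rewrite /F; case: ifP => _; [exact: measurable_square|exact: measurable0].
Qed.

End Area.

(** * Square integrable functions *)

Section SquareIntegrable.
Context {R : realType}.
Local Notation plane := (R * R)%type.
Local Notation mplane := (measurableTypeR R * measurableTypeR R)%type.
Local Notation area := (@lebesgue_measure R \x @lebesgue_measure R)%E.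
Local Notation nrm := (@ComplexField.Normc.normc R).
Local Notation B := (bicomplex R).
Implicit Types (g h : plane -> R) (u v : plane -> R[i]).
Variable Omega : set plane.
Hypothesis mO : measurable (Omega : set mplane).

(** Real square integrable functions on [Omega]. *)
Definition sqint g := @measurable_fun _ _ mplane R Omega g /\
  area.-integrable (Omega : set mplane) (EFin \o (fun z => g z ^+ 2)).

Lemma measurable_sq g : @measurable_fun _ _ mplane R Omega g ->
  @measurable_fun _ _ mplane R Omega (fun z => g z ^+ 2).
Proof. by move=> mg; exact: (measurable_funM mg mg). Qed.

Lemma sqint_prod g h : sqint g -> sqint h ->
  area.-integrable (Omega : set mplane) (EFin \o (fun z => g z * h z)).
Proof.
move=> [mg ig] [mh ih].
have igh := integrableD mO ig ih.
apply: (le_integrable mO _ _ igh).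
  by apply/measurable_EFinP; exact: measurable_funM.
move=> z _ /=; rewrite lee_fin.
rewrite [leRHS]ger0_norm ?addr_ge0 ?sqr_ge0// ler_norml.
have := sqr_ge0 (g z + h z); have := sqr_ge0 (g z - h z).
have := sqr_ge0 (g z); have := sqr_ge0 (h z).
by move: (g z) (h z) => x y h1 h2 h3 h4; apply/andP; split; nra.
Qed.

Lemma sqintZ c g : sqint g -> sqint (fun z => c * g z).
Proof.
move=> [mg ig]; split; first by apply: measurable_funM => //; exact: measurable_cst.
have := integrableZl mO (c ^+ 2) ig; apply: eq_integrable => // z _ /=.
by rewrite exprMn EFinM.
Qed.

Lemma sqintD g h : sqint g -> sqint h -> sqint (fun z => g z + h z).
Proof.
move=> sg sh; have igh := sqint_prod sg sh; case: sg sh => mg ig [mh ih].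
split; first exact: measurable_funD.
have := integrableD mO (integrableD mO ig ih) (integrableZl mO 2 igh).
apply: eq_integrable => // z _ /=.
by rewrite -EFinM -!EFinD; congr EFin; ring.
Qed.

Lemma sqint0 : sqint (fun=> 0).
Proof.
split; first exact: measurable_cst.
rewrite (_ : EFin \o _ = cst 0%E); first exact: integrable0.
by apply/funext => z /=; rewrite expr0n.
Qed.

Lemma L2P u : L2 Omega u <->
  sqint (fun z => complex.Re (u z)) /\ sqint (fun z => complex.Im (u z)).
Proof.
have E z : nrm (u z) ^+ 2 = complex.Re (u z) ^+ 2 + complex.Im (u z) ^+ 2 := nrm_sqr _.
split=> [[mr mi fin]|[[mr ir] [mi ii]]].
  have mn : @measurable_fun _ _ mplane R Omega (fun z => nrm (u z) ^+ 2).
    rewrite (_ : (fun z => _) = (fun z => complex.Re (u z) ^+ 2 + complex.Im (u z) ^+ 2)).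
      by apply: measurable_funD; exact: measurable_sq.
    by apply/funext.
  have iN : area.-integrable (Omega : set mplane) (EFin \o (fun z => nrm (u z) ^+ 2)).
    apply/integrableP; split; first exact/measurable_EFinP.
    rewrite (eq_integral (fun z : mplane => (nrm (u z) ^+ 2)%:E))// => z _ /=.
    by rewrite ger0_norm// sqr_ge0.
  split; split => //; apply: (le_integrable mO _ _ iN).
  - by apply/measurable_EFinP; exact: measurable_sq.
  - by move=> z _; rewrite /= lee_fin E !ger0_norm ?addr_ge0 ?sqr_ge0// lerDl sqr_ge0.
  - by apply/measurable_EFinP; exact: measurable_sq.
  - by move=> z _; rewrite /= lee_fin E !ger0_norm ?addr_ge0 ?sqr_ge0// lerDr sqr_ge0.
split=> //.
have /integrableP[_] := integrableD mO ir ii.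
rewrite (eq_integral (fun z : mplane => (nrm (u z) ^+ 2)%:E))// => z _ /=.
by rewrite E ger0_norm// addr_ge0 ?sqr_ge0.
Qed.

(** Integrability of a complex-valued function, by components. *)
Definition cintegrable u :=
  area.-integrable (Omega : set mplane) (EFin \o (fun z => complex.Re (u z))) /\
  area.-integrable (Omega : set mplane) (EFin \o (fun z => complex.Im (u z))).

Lemma cintegral_linear a u v : cintegrable u -> cintegrable v ->
  cintegral Omega (fun z => a * u z + v z) = a * cintegral Omega u + cintegral Omega v.
Proof.
move=> [ur ui] [vr vi].
have Zr c g (ig : area.-integrable (Omega : set mplane) (EFin \o g)) :
   area.-integrable (Omega : set mplane) (EFin \o (fun z => c * g z)).
  by have := integrableZl mO c ig; apply: eq_integrable.
have DD g h (ig : area.-integrable (Omega : set mplane) (EFin \o g))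
   (ih : area.-integrable (Omega : set mplane) (EFin \o h)) :
   area.-integrable (Omega : set mplane) (EFin \o (fun z => g z + h z)).
  by have := integrableD mO ig ih; apply: eq_integrable.
pose ar := complex.Re a; pose ai := complex.Im a.
rewrite /cintegral.
have -> : (fun z => complex.Re (a * u z + v z)) =
    (fun z => (ar * complex.Re (u z) + (- ai) * complex.Im (u z)) + complex.Re (v z)).
  by apply/funext => z; rewrite ReD ReM mulNr.
have -> : (fun z => complex.Im (a * u z + v z)) =
    (fun z => (ar * complex.Im (u z) + ai * complex.Re (u z)) + complex.Im (v z)).
  by apply/funext => z; rewrite ImD ImM.
rewrite (RintegralD mO (DD _ _ (Zr ar _ ur) (Zr (- ai) _ ui)) vr).
rewrite (RintegralD mO (DD _ _ (Zr ar _ ui) (Zr ai _ ur)) vi).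
rewrite (RintegralD mO (Zr ar _ ur) (Zr (- ai) _ ui)).
rewrite (RintegralD mO (Zr ar _ ui) (Zr ai _ ur)).
rewrite !(RintegralZl _ mO ur) !(RintegralZl _ mO ui).
by apply/eqP; rewrite eq_complex ReD ImD ReM ImM /= mulNr !eqxx.
Qed.

Lemma cintegral_conj u : cintegrable u ->
  cintegral Omega (fun z => (u z)^*) = (cintegral Omega u)^*.
Proof.
move=> [ur ui]; rewrite /cintegral /=.
have -> : (fun z => complex.Re (u z)^*) = (fun z => complex.Re (u z)).
  by apply/funext => z; case: (u z).
have -> : (fun z => complex.Im (u z)^*) = (fun z => (-1) * complex.Im (u z)).
  by apply/funext => z; case: (u z) => x y /=; rewrite mulN1r.
by rewrite (RintegralZl _ mO ui) mulN1r.
Qed.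

Lemma Re_mulJ (a b : R[i]) : complex.Re (a * b^*) =
  complex.Re a * complex.Re b + complex.Im a * complex.Im b.
Proof. by case: a b => ? ? [? ?] /=; rewrite mulrN opprK. Qed.

Lemma Im_mulJ (a b : R[i]) : complex.Im (a * b^*) =
  complex.Im a * complex.Re b + (-1) * (complex.Re a * complex.Im b).
Proof. by case: a b => ? ? [? ?] /=; ring. Qed.

Lemma L2_mulJ_integrable u v : L2 Omega u -> L2 Omega v ->
  cintegrable (fun z => u z * (v z)^*).
Proof.
move=> /L2P[ur ui] /L2P[vr vi]; split.
  have := integrableD mO (sqint_prod ur vr) (sqint_prod ui vi).
  by apply: eq_integrable => // z _ /=; rewrite Re_mulJ.
have := integrableD mO (sqint_prod ui vr) (integrableZl mO (-1) (sqint_prod ur vi)).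
by apply: eq_integrable => // z _ /=; rewrite Im_mulJ -EFinM -EFinD.
Qed.

Lemma L2b_dotb_integrable (F G : plane -> B) : L2b Omega F -> L2b Omega G ->
  cintegrable (fun z => dotb (F z) (G z)).
Proof.
move=> [Fs Fv] [Gs Gv].
have [r1 i1] := L2_mulJ_integrable Fs Gs; have [r2 i2] := L2_mulJ_integrable Fv Gv.
split.
  have := integrableD mO r1 r2.
  by apply: eq_integrable => // z _ /=; rewrite /dotb ReD.
have := integrableD mO i1 i2.
by apply: eq_integrable => // z _ /=; rewrite /dotb ImD.
Qed.

Lemma L2_linear a u v : L2 Omega u -> L2 Omega v -> L2 Omega (fun z => a * u z + v z).
Proof.
move=> /L2P[ur ui] /L2P[vr vi]; apply/L2P; split.
  rewrite (_ : (fun z => _) = (fun z => (complex.Re a * complex.Re (u z) +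
     (- complex.Im a) * complex.Im (u z)) + complex.Re (v z))).
    by apply: sqintD => //; apply: sqintD; exact: sqintZ.
  by apply/funext => z; rewrite ReD ReM mulNr.
rewrite (_ : (fun z => _) = (fun z => (complex.Re a * complex.Im (u z) +
     complex.Im a * complex.Re (u z)) + complex.Im (v z))).
  by apply: sqintD => //; apply: sqintD; exact: sqintZ.
by apply/funext => z; rewrite ImD ImM.
Qed.

End SquareIntegrable.

(** * Locally uniform limits *)

Section C1Limit.
Context {R : realType}.
Local Notation plane := (R * R)%type.
Implicit Types (O : set plane) (g : nat -> plane -> R) (z w v : plane).

(** [g] is a Cauchy sequence for the supremum norm on [D]. *)
Definition uniformly_cauchy (D : set plane) g := forall e : R, 0 < e ->
  exists N, forall m n w, (N <= m)%N -> (N <= n)%N -> D w -> `|g m w - g n w| < e.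

Lemma uniformly_cauchy_cvg D g w : uniformly_cauchy D g -> D w ->
  (fun n => g n w) @ \oo --> limn (fun n => g n w).
Proof.
move=> Cg Dw; apply/cauchy_cvgP/cauchy_exP => e e0.
have [N HN] := Cg e e0.
exists (g N w); exists N => // n /= Nn; rewrite -ball_normE /=; exact: HN.
Qed.

Lemma uniformly_cauchy_limit D g : uniformly_cauchy D g ->
  forall e : R, 0 < e -> exists N, forall n w, (N <= n)%N -> D w ->
    `|g n w - limn (fun n => g n w)| <= e.
Proof.
move=> Cg e e0; have [N HN] := Cg e e0; exists N => n w Nn Dw.
have cw := uniformly_cauchy_cvg Cg Dw.
have c : (fun m => `|g n w - g m w|) @ \oo --> `|g n w - limn (fun n => g n w)|.
  by apply: cvg_norm; apply: cvgB; [exact: cvg_cst|exact: cw].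
rewrite leNgt; apply/negP => lt.
have H : \forall m \near \oo, e < `|g n w - g m w| by exact: (cvgr_gt _ c _ lt).
near \oo => m.
have : e < `|g n w - g m w| by near: m; exact: H.
rewrite ltNge => /negP; apply; apply: ltW; apply: HN => //.
by near: m; exists N.
Unshelve. all: by end_near.
Qed.

Lemma uniform_limit_continuous z (r : R) g : 0 < r ->
  (forall n, {for z, continuous (g n)}) -> uniformly_cauchy (ball z r) g ->
  {for z, continuous (fun w => limn (fun n => g n w))}.
Proof.
move=> r0 cg Cg; apply/cvgrPdist_le => e e0.
have e30 : 0 < e / 3 by exact: divr_gt0.
have [N HN] := uniformly_cauchy_limit Cg e30.
have nb : nbhs z (ball z r) by apply/nbhs_ballP; exists r.
have H : \forall w \near z, `|g N z - g N w| <= e / 3.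
  by have /cvgrPdist_le/(_ _ e30) := cg N.
apply: filterS2 nb H => w wr {}H.
have h1 := HN N z (leqnn N) (ballxx z r0); have h2 := HN N w (leqnn N) wr.
rewrite distrC in h1.
move: H h1 h2; set a := g N z; set b := g N w; set c := limn _; set d := limn _.
move=> H h1 h2.
rewrite (_ : c - d = (c - a) + (a - b) + (b - d)); last by ring.
rewrite (_ : e = e / 3 + e / 3 + e / 3); last by field.
by rewrite (le_trans (ler_normD _ _))// lerD// (le_trans (ler_normD _ _))// lerD.
Qed.

(** The limit of the derivatives is the derivative of the limit: by the mean value
    theorem the difference quotients of [g n] are close to the limit derivative,
    uniformly in [n]. *)
Lemma uniform_limit_is_derive z v (r : R) g : 0 < r -> `|v| <= 1 ->
  (forall n w, ball z r w -> derivable (g n) w v) ->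
  (forall n, {for z, continuous ('D_v (g n))}) ->
  uniformly_cauchy (ball z r) g ->
  uniformly_cauchy (ball z r) (fun n => 'D_v (g n)) ->
  is_derive z v (fun w => limn (fun n => g n w)) (limn (fun n => 'D_v (g n) z)).
Proof.
move=> r0 v1 dg cdg Cg Cdg.
pose l w := limn (fun n => g n w).
pose dl w := limn (fun n => 'D_v (g n) w).
have cdl : {for z, continuous dl} := uniform_limit_continuous r0 cdg Cdg.
have key : h^-1 *: ((l \o shift z) (h *: v) - l z) @[h --> 0^'] --> dl z.
  apply/cvgrPdist_le => e e0.
  have e20 : 0 < e / 2 by exact: divr_gt0.
  have [N HN] := uniformly_cauchy_limit Cdg e20.
  have /nbhs_ballP[d /= d0 Hd] : \forall w \near z, `|dl z - dl w| <= e / 2.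
    by have /cvgrPdist_le/(_ _ e20) := cdl.
  pose rho := Num.min r d.
  have rho0 : 0 < rho by rewrite lt_min r0.
  have inb (t h : R) : `|t| <= `|h| -> `|h| < rho -> `|z - (z + t *: v)| < rho.
    move=> th hr; rewrite opprD addNKr normrN normrZ.
    by rewrite (le_lt_trans _ hr)// (le_trans _ th)// ler_piMr.
  have inr w : `|z - w| < rho -> ball z r w.
    by rewrite -ball_normE /= => /lt_le_trans; apply; rewrite ge_min lexx.
  have ind w : `|z - w| < rho -> ball z d w.
    by rewrite -ball_normE /= => /lt_le_trans; apply; rewrite ge_min lexx orbT.
  have est (h : R) : h != 0 -> `|h| < rho -> `|dl z - h^-1 * (l (h *: v + z) - l z)| <= e.
    move=> h0 hr.
    have zr : ball z r z by exact: ballxx.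
    have hz : ball z r (h *: v + z) by rewrite addrC; apply: inr; exact: inb hr.
    have c1 := uniformly_cauchy_cvg Cg hz; have c2 := uniformly_cauchy_cvg Cg zr.
    have c : (fun n => `|dl z - h^-1 * (g n (h *: v + z) - g n z)|) @ \oo -->
        `|dl z - h^-1 * (l (h *: v + z) - l z)|.
      apply: cvg_norm; apply: cvgB; first exact: cvg_cst.
      by apply: cvgM; [exact: cvg_cst|apply: cvgB; [exact: c1|exact: c2]].
    have bnd n : (N <= n)%N -> `|dl z - h^-1 * (g n (h *: v + z) - g n z)| <= e.
      move=> Nn.
      have [t th E] := @MVT_line R (g n) z v h (fun t th => dg n _ (inr _ (inb t h th hr))).
      rewrite (addrC (h *: v) z) E mulrA mulVf// mul1r.
      have tz := inb t h th hr.
      have h1 := HN n _ Nn (inr _ tz); have h2 := Hd _ (ind _ tz).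
      rewrite (splitr e) (_ : dl z - _ = (dl z - dl (z + t *: v)) -
        ('D_v (g n) (z + t *: v) - dl (z + t *: v))); last by ring.
      by rewrite (le_trans (ler_normB _ _))// lerD.
    rewrite leNgt; apply/negP => lt.
    have H : \forall n \near \oo, e < `|dl z - h^-1 * (g n (h *: v + z) - g n z)|.
      by exact: (cvgr_gt _ c _ lt).
    near \oo => n.
    have : e < `|dl z - h^-1 * (g n (h *: v + z) - g n z)| by near: n; exact: H.
    by rewrite ltNge bnd//; near: n; exists N.
  near=> h; apply: est.
    by near: h; exact: nbhs_dnbhs_neq.
  near: h; apply: nbhs_dnbhs; apply/nbhs_ballP; exists rho => //= h.
  by rewrite -ball_normE /= sub0r normrN.
by split; [apply/cvg_ex; exists (dl z)|exact: cvg_lim key].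
Unshelve. all: by end_near.
Qed.

(** Locally uniform limits in [C1]. *)
Lemma C1_real_limit O g : open O -> (forall n, C1_real O (g n)) ->
  (forall z, O z -> exists2 r : R, 0 < r & [/\ uniformly_cauchy (ball z r) g,
     uniformly_cauchy (ball z r) (fun n => 'D_ex (g n)) &
     uniformly_cauchy (ball z r) (fun n => 'D_ey (g n))]) ->
  let l := fun w => limn (fun n => g n w) in
  C1_real O l /\ forall z, O z -> [/\ (fun n => g n z) @ \oo --> l z,
     (fun n => 'D_ex (g n) z) @ \oo --> 'D_ex l z &
     (fun n => 'D_ey (g n) z) @ \oo --> 'D_ey l z].
Proof.
move=> oO C1g loc l.
have loc' z : O z -> exists2 r : R, 0 < r & [/\ ball z r `<=` O, uniformly_cauchy (ball z r) g,
     uniformly_cauchy (ball z r) (fun n => 'D_ex (g n)) &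
     uniformly_cauchy (ball z r) (fun n => 'D_ey (g n))].
  move=> Oz; have [r r0 [u1 u2 u3]] := loc z Oz.
  have /nbhs_ballP[e /= e0 He] : nbhs z O by exact: open_nbhs_nbhs.
  have m0 : 0 < Num.min r e by rewrite lt_min r0.
  have sr : ball z (Num.min r e) `<=` ball z r by apply: le_ball; rewrite ge_min lexx.
  have se : ball z (Num.min r e) `<=` ball z e by apply: le_ball; rewrite ge_min lexx orbT.
  have sub h : uniformly_cauchy (ball z r) h -> uniformly_cauchy (ball z (Num.min r e)) h.
    by move=> H d /H[N HN]; exists N => m n w Nm Nn /sr; exact: HN.
  exists (Num.min r e) => //.
  by split; [exact: subset_trans se He|exact: sub|exact: sub|exact: sub].
have n1 : `|ex : plane| <= 1 by rewrite plane_norm normr1 normr0 ge_max lexx ler01.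
have n2 : `|ey : plane| <= 1 by rewrite plane_norm normr1 normr0 ge_max lexx ler01.
have dx z : O z -> is_derive z (ex : plane) l (limn (fun n => 'D_ex (g n) z)).
  move=> Oz; have [r r0 [rO u1 u2 u3]] := loc' z Oz.
  apply: (uniform_limit_is_derive r0 n1) => //.
    by move=> n w /rO /(C1g n)[_ [? _] _].
  by move=> n; have [_ [_ ?] _] := C1g n z Oz.
have dy z : O z -> is_derive z (ey : plane) l (limn (fun n => 'D_ey (g n) z)).
  move=> Oz; have [r r0 [rO u1 u2 u3]] := loc' z Oz.
  apply: (uniform_limit_is_derive r0 n2) => //.
    by move=> n w /rO /(C1g n)[_ _ [? _]].
  by move=> n; have [_ _ [_ ?]] := C1g n z Oz.
split.
  apply: (@C1_realI R O l _ _ oO dx dy) => z Oz.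
  have [r r0 [rO u1 u2 u3]] := loc' z Oz; split.
  - by apply: (uniform_limit_continuous r0 _ u1) => n; have [] := C1g n z Oz.
  - by apply: (uniform_limit_continuous r0 _ u2) => n; have [_ [_ ?] _] := C1g n z Oz.
  - by apply: (uniform_limit_continuous r0 _ u3) => n; have [_ _ [_ ?]] := C1g n z Oz.
move=> z Oz; have [r r0 [rO u1 u2 u3]] := loc' z Oz.
have zr : ball z r z by exact: ballxx.
have [_ ->] := dx z Oz; have [_ ->] := dy z Oz.
by split; [exact: (uniformly_cauchy_cvg u1 zr)|exact: (uniformly_cauchy_cvg u2 zr)
  |exact: (uniformly_cauchy_cvg u3 zr)].
Qed.

End C1Limit.

(** * The norm of L2 and its control of the values *)

Section L2Norm.
Context {R : realType}.
Local Notation plane := (R * R)%type.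
Local Notation mplane := (measurableTypeR R * measurableTypeR R)%type.
Local Notation area := (@lebesgue_measure R \x @lebesgue_measure R)%E.
Local Notation nrm := (@ComplexField.Normc.normc R).
Local Notation B := (bicomplex R).
Implicit Types (W F G : plane -> B).
Variable Omega : set plane.
Hypothesis mO : measurable (Omega : set mplane).

(** The square of the Euclidean norm of a bicomplex number. *)
Definition sqb (w : B) : R := nrm (Sc w) ^+ 2 + nrm (Vec w) ^+ 2.

Lemma sqb_ge0 w : 0 <= sqb w.
Proof. by rewrite addr_ge0 ?sqr_ge0. Qed.

Lemma dotb_self (w : B) : dotb w w = (sqb w)%:C.
Proof.
apply/eqP; rewrite eq_complex /dotb ReD ImD !Re_mulJ !Im_mulJ /sqb !nrm_sqr /= !expr2.
by rewrite eqxx /=; apply/eqP; ring.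
Qed.

Lemma sqb_measurable W : L2b Omega W ->
  @measurable_fun _ _ mplane R Omega (fun z => sqb (W z)).
Proof.
move=> [[mr mi _] [nr ni _]].
rewrite (_ : (fun z => _) = fun z =>
  (complex.Re (Sc (W z)) ^+ 2 + complex.Im (Sc (W z)) ^+ 2) +
  (complex.Re (Vec (W z)) ^+ 2 + complex.Im (Vec (W z)) ^+ 2)); last first.
  by apply/funext => z; rewrite /sqb !nrm_sqr.
by apply: measurable_funD; apply: measurable_funD; exact: measurable_sq.
Qed.

Lemma sqb_integrable W : L2b Omega W ->
  area.-integrable (Omega : set mplane) (EFin \o (fun z => sqb (W z))).
Proof.
move=> LW; have [i _] := L2b_dotb_integrable mO LW LW.
by apply: eq_integrable i => // z _ /=; rewrite dotb_self.
Qed.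

Lemma dotL2b_self W : dotL2b Omega W W =
  (Rintegral area Omega (fun z => sqb (W z)))%:C.
Proof.
rewrite /dotL2b /cintegral; congr Complex.
  by congr Rintegral; apply/funext => z; rewrite dotb_self.
rewrite (_ : (fun z => _) = fun=> 0); last by apply/funext => z; rewrite dotb_self.
by rewrite (Rintegral_cst _ mO) mul0r.
Qed.

Lemma dot_norm_sqr W : L2b Omega W ->
  (\int[area]_(z in (Omega : set mplane)) (sqb (W z))%:E)%E =
  (dot_norm (dotL2b Omega) W ^+ 2)%:E.
Proof.
move=> LW; rewrite /dot_norm dotL2b_self /= sqr_sqrtr; last first.
  by apply: Rintegral_ge0 => z _; exact: sqb_ge0.
by rewrite /Rintegral fineK//; exact: integrable_fin_num (sqb_integrable LW).
Qed.

Lemma dot_norm_ge0 W : 0 <= dot_norm (dotL2b Omega) W.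
Proof. exact: sqrtr_ge0. Qed.

(** If [Sc W] or [Vec W] were larger than [N / (2 d)] at every point of a square of
    half-side [d], of area [4 d^2], the norm of [W] would be at least [N]. *)
Lemma square_mean_dot_norm W (N : R) : L2b Omega W ->
  dot_norm (dotL2b Omega) W < N -> square_mean_le Omega W N.
Proof.
move=> LW WN z d d0 sub; apply: contrapT => H.
have N0 : 0 < N by exact: le_lt_trans (dot_norm_ge0 W) WN.
have d20 : 0 < 2 * d by exact: mulr_gt0.
have big w : ball z d w -> (N / (2 * d)) ^+ 2 <= sqb (W w).
  move=> zw; have ND : 0 <= N / (2 * d) by rewrite ltW// divr_gt0.
  have [h1|h1] := leP (nrm (Sc (W w))) (N / (2 * d)).
    have [h2|h2] := leP (nrm (Vec (W w))) (N / (2 * d)).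
      by exfalso; apply: H; exists w.
    apply: (@le_trans _ _ (nrm (Vec (W w)) ^+ 2)).
      by rewrite ler_pXn2r ?nnegrE// ?nrm_ge0// ltW.
    by rewrite /sqb lerDr sqr_ge0.
  apply: (@le_trans _ _ (nrm (Sc (W w)) ^+ 2)).
    by rewrite ler_pXn2r ?nnegrE// ?nrm_ge0// ltW.
  by rewrite /sqb lerDl sqr_ge0.
have mb := measurable_square z d.
have I1 : ((N ^+ 2)%:E <= \int[area]_(w in (ball z d : set mplane)) (sqb (W w))%:E)%E.
  have -> : (N ^+ 2)%:E = (\int[area]_(w in (ball z d : set mplane)) ((N / (2 * d)) ^+ 2)%:E)%E.
    rewrite (integral_cst _ mb) [X in (_ * X)%E](area_square z d0) -EFinM; congr EFin.
    by field; rewrite gt_eqF.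
  have m1 : @measurable_fun _ _ mplane _ (ball z d) (fun w => (sqb (W w))%:E).
    by apply/measurable_EFinP; exact: (measurable_funS mO sub (sqb_measurable LW)).
  apply: (@ge0_le_integral _ mplane R area (ball z d) mb).
  - by move=> w _; rewrite lee_fin sqr_ge0.
  - exact: measurable_cst.
  - exact: m1.
  - by move=> w zw; rewrite lee_fin; exact: big.
have I2 : (\int[area]_(w in (ball z d : set mplane)) (sqb (W w))%:E <=
           \int[area]_(w in (Omega : set mplane)) (sqb (W w))%:E)%E.
  apply: ge0_subset_integral => //.
  - by apply/measurable_EFinP; exact: sqb_measurable.
  - by move=> w _; rewrite lee_fin sqb_ge0.
have := le_trans I1 I2; rewrite dot_norm_sqr// lee_fin leNgt.
by rewrite ltr_pXn2r ?nnegrE ?dot_norm_ge0 ?(ltW N0)// WN.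
Qed.

(** Fatou's lemma for a pointwise convergent sequence. *)
Lemma fatou_le (h : nat -> plane -> R) (l : plane -> R) (c : R) :
  (forall n, @measurable_fun _ _ mplane R Omega (h n)) ->
  (forall n z, Omega z -> 0 <= h n z) ->
  (forall z, Omega z -> (fun n => h n z) @ \oo --> l z) ->
  (forall n, (\int[area]_(z in (Omega : set mplane)) (h n z)%:E <= c%:E)%E) ->
  (\int[area]_(z in (Omega : set mplane)) (l z)%:E <= c%:E)%E.
Proof.
move=> mh h0 hl hc.
have := @fatou _ mplane R area Omega mO (fun n z => (h n z)%:E) _ _.
move=> /(_ (fun n => (measurable_EFinP _ _).2 (mh n)))
  /(_ (fun n z Oz => (h0 n z Oz : (0 <= (h n z)%:E)%E))).
rewrite (eq_integral (fun z : mplane => (l z)%:E)); last first.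
  move=> z /set_mem Oz; apply/esym.
  have : (fun n => (h n z)%:E) @ \oo --> (l z)%:E by apply: cvg_EFin; [exact: nearW|exact: hl].
  by move=> /cvg_limn_einf_sup[].
move=> /le_trans; apply.
rewrite limn_einf_lim; apply: lime_le; first exact: is_cvg_einfs.
apply: nearW => n; apply: le_trans (hc n).
by apply: ereal_inf_lbound; exists n => //=.
Qed.

End L2Norm.

(** * The Bergman space *)

Section Bergman.
Context {R : realType}.
Local Notation plane := (R * R)%type.
Local Notation mplane := (measurableTypeR R * measurableTypeR R)%type.
Local Notation area := (@lebesgue_measure R \x @lebesgue_measure R)%E.
Local Notation nrm := (@ComplexField.Normc.normc R).
Local Notation B := (bicomplex R).
Local Notation SW W := (fun z => Sc (W z)).
Local Notation VW W := (fun z => Vec (W z)).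
Variables (Omega : set plane) (f : plane -> R[i]).
Hypothesis oO : open Omega.
Hypothesis C1f : C1 Omega f.
Hypothesis f0 : forall z, Omega z -> f z != 0.
Local Notation A := (bergman Omega f).
Local Notation dot := (dotL2b Omega).
Implicit Types (U V W : plane -> B).

Let mO : measurable (Omega : set mplane) := open_plane_measurable oO.

Lemma bergmanP W : A W <-> [/\ forall z, ~ Omega z -> W z = 0, C1b Omega W, L2b Omega W
  & forall z, Omega z -> vekua_at f W z].
Proof.
by split=> -[h1 h2 h3 h4]; split=> // z Oz; have := h4 z Oz; [move/(vekuaP W (f0 Oz))|
  move=> ?; exact/(vekuaP W (f0 Oz))].
Qed.

Lemma pderivc_linear v (a : R[i]) (p q : plane -> R[i]) z :
  cderivable v p z -> cderivable v q z ->
  pderivc v (fun z => a * p z + q z) z = a * pderivc v p z + pderivc v q z.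
Proof.
move=> dp dq.
have dap : cderivable v (fun z => a * p z) z.
  case: dp => d1 d2; split.
    rewrite (_ : (fun z => _) =
      complex.Re a *: (fun z => complex.Re (p z)) - complex.Im a *: (fun z => complex.Im (p z))).
      exact: (derivableB (derivableZ d1) (derivableZ d2)).
    by apply/funext => t; rewrite ReM.
  rewrite (_ : (fun z => _) =
    complex.Re a *: (fun z => complex.Im (p z)) + complex.Im a *: (fun z => complex.Re (p z))).
    exact: (derivableD (derivableZ d2) (derivableZ d1)).
  by apply/funext => t; rewrite ImM.
by rewrite (pderivcD dap dq) (pderivcM (cderivable_cst v a z) dp) pderivc_cst mul0r add0r.
Qed.

Lemma C1b_cderivable W z : C1b Omega W -> Omega z ->
  [/\ cderivable ex (SW W) z, cderivable ey (SW W) z, cderivable ex (VW W) z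
    & cderivable ey (VW W) z].
Proof.
by move=> [c1 c2] Oz; have [? ?] := C1_cderivable c1 Oz; have [? ?] := C1_cderivable c2 Oz.
Qed.

Lemma pderivc_Sc_linear v (a : R[i]) U V z : cderivable v (SW U) z -> cderivable v (SW V) z ->
  pderivc v (SW (a *: U + V)) z = a * pderivc v (SW U) z + pderivc v (SW V) z.
Proof. exact: pderivc_linear. Qed.

Lemma pderivc_Vec_linear v (a : R[i]) U V z : cderivable v (VW U) z -> cderivable v (VW V) z ->
  pderivc v (VW (a *: U + V)) z = a * pderivc v (VW U) z + pderivc v (VW V) z.
Proof. exact: pderivc_linear. Qed.

Lemma bergman_linear (a : R[i]) U V : A U -> A V -> A (a *: U + V).
Proof.
move=> /bergmanP[U0 U1 U2 U3] /bergmanP[V0 V1 V2 V3]; apply/bergmanP; split.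
- move=> z nz; rewrite -[LHS]/(a *: U z + V z) U0// V0//; by rewrite scaler0 addr0.
- split; [exact: (C1D oO (C1M oO (C1_cst a oO) U1.1) V1.1)
         |exact: (C1D oO (C1M oO (C1_cst a oO) U1.2) V1.2)].
- by split; [exact: (L2_linear mO a U2.1 V2.1)|exact: (L2_linear mO a U2.2 V2.2)].
- move=> z Oz; have [u1 u2] := U3 z Oz; have [v1 v2] := V3 z Oz.
  have [d1 d2 d3 d4] := C1b_cderivable U1 Oz; have [e1 e2 e3 e4] := C1b_cderivable V1 Oz.
  rewrite /vekua_at (pderivc_Sc_linear a d1 e1) (pderivc_Sc_linear a d2 e2)
    (pderivc_Vec_linear a d3 e3) (pderivc_Vec_linear a d4 e4).
  rewrite -[Sc ((a *: U + V) z)]/(a * Sc (U z) + Sc (V z)).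
  rewrite -[Vec ((a *: U + V) z)]/(a * Vec (U z) + Vec (V z)).
  split.
    transitivity (a * (f z * (pderivc ex (SW U) z - pderivc ey (VW U) z)) +
      f z * (pderivc ex (SW V) z - pderivc ey (VW V) z)); first by ring.
    by rewrite u1 v1; ring.
  transitivity (a * (f z * (pderivc ey (SW U) z + pderivc ex (VW U) z)) +
      f z * (pderivc ey (SW V) z + pderivc ex (VW V) z)); first by ring.
  by rewrite u2 v2; ring.
Qed.

Lemma bergman0 : A 0.
Proof.
apply/bergmanP; split; first by [].
- by split; exact: C1_cst.
- by split; apply/(L2P mO); split; exact: sqint0.
- move=> z Oz; rewrite /vekua_at.
  rewrite -[Sc ((0 : plane -> B) z)]/(0 : R[i]) -[Vec ((0 : plane -> B) z)]/(0 : R[i]).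
  by rewrite !pderivc_cst !subr0 !addr0 !mulr0 addr0 subr0.
Qed.

Lemma bergman_subspace : complex_subspace A.
Proof. by split; [exact: bergman0|move=> a U V; exact: bergman_linear]. Qed.

Lemma bergmanB U V : A U -> A V -> A (U - V).
Proof.
by move=> AU AV; rewrite (_ : U - V = (-1) *: V + U);
  [exact: bergman_linear|rewrite scaleN1r addrC].
Qed.

(** Near each point of [Omega], the values and the first derivatives of an
    element of the space are bounded by its norm. *)
Lemma bergman_bound z0 : Omega z0 -> exists r C : R, [/\ 0 < r, 0 <= C, ball z0 r `<=` Omega &
  forall W (N : R), A W -> dot_norm dot W < N -> forall w, ball z0 r w ->
   [/\ nrm (Sc (W w)) <= C * N, nrm (Vec (W w)) <= C * N,
       nrm (pderivc ex (SW W) w) <= C * N /\ nrm (pderivc ey (SW W) w) <= C * N &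
       nrm (pderivc ex (VW W) w) <= C * N /\ nrm (pderivc ey (VW W) w) <= C * N]].
Proof.
move=> Oz; have [r [C [r0 C0 rO H]]] := interior_estimate oO C1f f0 Oz.
exists r, C; split=> // W N /bergmanP[W0 W1 W2 W3] WN; apply: H => //.
  exact: le_trans (dot_norm_ge0 Omega W) (ltW WN).
exact: square_mean_dot_norm.
Qed.

(** The interior bound by every [N > 0] forces [W] to vanish. *)
Lemma dot_norm_eq0 W : A W -> dot_norm dot W <= 0 -> W = 0.
Proof.
move=> AW W0; apply/funext => z; apply: contrapT => Wz.
have Oz : Omega z.
  by apply: contrapT => nz; apply: Wz; have /bergmanP[+ _ _ _] := AW; apply.
have [r [C [r0 C0 rO H]]] := bergman_bound Oz.
have small (c : R[i]) : (forall e, 0 < e -> nrm c <= C * e) -> c = 0.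
  move=> hc; apply/eqP; apply: contrapT => /negP c0.
  have n0 := nrm_gt0 c0.
  have C1 : 0 < C + 1 by exact: ltr_wpDl.
  have := hc (nrm c / (C + 1)) (divr_gt0 n0 C1).
  rewrite mulrCA -[leLHS]mulr1 ler_pM2l// ler_pdivlMr// mul1r leNgt.
  by rewrite ltrDl ltr01.
apply: Wz; apply: bicomplex_eq; apply: small => e e0;
  by have [h1 h2 _ _] := H W e AW (le_lt_trans W0 e0) z (ballxx z r0).
Qed.

Lemma dotb_linear (a : R[i]) (x y t : B) : dotb (a *: x + y) t = a * dotb x t + dotb y t.
Proof. by rewrite /dotb ScD VecD ScZ VecZ; ring. Qed.

Lemma dotb_conj (x y : B) : dotb y x = (dotb x y)^*.
Proof.
case: x => [[a b] [c d]]; case: y => [[a' b'] [c' d']].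
by apply/eqP; rewrite eq_complex /dotb /=; apply/andP; split; apply/eqP; ring.
Qed.

Lemma bergman_inner_product : inner_product_on A dot.
Proof.
split.
- move=> a U V W /bergmanP[_ _ U2 _] /bergmanP[_ _ V2 _] /bergmanP[_ _ W2 _].
  rewrite /dotL2b -(cintegral_linear mO a (L2b_dotb_integrable mO U2 W2)
    (L2b_dotb_integrable mO V2 W2)).
  by congr cintegral; apply/funext => z; rewrite -dotb_linear.
- move=> U V /bergmanP[_ _ U2 _] /bergmanP[_ _ V2 _].
  rewrite /dotL2b -(cintegral_conj mO (L2b_dotb_integrable mO U2 V2)).
  by congr cintegral; apply/funext => z; rewrite -dotb_conj.
- move=> U AU U0.
  have n0 : 0 < dot_norm dot U.
    by rewrite ltNge; apply/negP => /(dot_norm_eq0 AU).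
  rewrite (dotL2b_self mO U) ltcR; move: n0.
  by rewrite /dot_norm (dotL2b_self mO U) /= sqrtr_gt0.
Qed.

End Bergman.

(** * Completeness *)

Section ComplexLimits.
Context {R : realType}.
Implicit Types (s t : nat -> R[i]) (a b : R[i]).

(** Convergence of complex sequences, by real and imaginary parts. *)
Definition ccvg s a := (fun n => complex.Re (s n)) @ \oo --> complex.Re a /\
  (fun n => complex.Im (s n)) @ \oo --> complex.Im a.

Lemma ccvg_cst a : ccvg (fun=> a) a.
Proof. by split; exact: cvg_cst. Qed.

Lemma ccvgD s t a b : ccvg s a -> ccvg t b -> ccvg (fun n => s n + t n) (a + b).
Proof.
move=> [sr si] [tr ti]; rewrite /ccvg ReD ImD; split.
  rewrite (_ : (fun n => _) = fun n => complex.Re (s n) + complex.Re (t n)).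
    exact: (cvgD sr tr).
  by apply/funext => n; rewrite ReD.
rewrite (_ : (fun n => _) = fun n => complex.Im (s n) + complex.Im (t n)).
  exact: (cvgD si ti).
by apply/funext => n; rewrite ImD.
Qed.

Lemma ccvgM s t a b : ccvg s a -> ccvg t b -> ccvg (fun n => s n * t n) (a * b).
Proof.
move=> [sr si] [tr ti]; rewrite /ccvg ReM ImM; split.
  rewrite (_ : (fun n => _) = fun n => complex.Re (s n) * complex.Re (t n) -
     complex.Im (s n) * complex.Im (t n)).
    exact: (cvgB (cvgM sr tr) (cvgM si ti)).
  by apply/funext => n; rewrite ReM.
rewrite (_ : (fun n => _) = fun n => complex.Re (s n) * complex.Im (t n) +
     complex.Im (s n) * complex.Re (t n)).
  exact: (cvgD (cvgM sr ti) (cvgM si tr)).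
by apply/funext => n; rewrite ImM.
Qed.

Lemma ccvgN s a : ccvg s a -> ccvg (fun n => - s n) (- a).
Proof.
move=> [sr si]; rewrite /ccvg ReN ImN; split.
  rewrite (_ : (fun n => _) = fun n => - complex.Re (s n)); first exact: (cvgN sr).
  by apply/funext => n; rewrite ReN.
rewrite (_ : (fun n => _) = fun n => - complex.Im (s n)); first exact: (cvgN si).
by apply/funext => n; rewrite ImN.
Qed.

Lemma ccvg_unique s a b : ccvg s a -> ccvg s b -> a = b.
Proof.
move=> [sr si] [tr ti]; apply/eqP; rewrite eq_complex.
have e1 : complex.Re a = complex.Re b by exact: (cvg_unique _ sr tr).
have e2 : complex.Im a = complex.Im b by exact: (cvg_unique _ si ti).
by rewrite e1 e2 !eqxx.
Qed.

End ComplexLimits.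

Section Completeness.
Context {R : realType}.
Local Notation plane := (R * R)%type.
Local Notation mplane := (measurableTypeR R * measurableTypeR R)%type.
Local Notation area := (@lebesgue_measure R \x @lebesgue_measure R)%E.
Local Notation nrm := (@ComplexField.Normc.normc R).
Local Notation B := (bicomplex R).
Local Notation SW W := (fun z => Sc (W z)).
Local Notation VW W := (fun z => Vec (W z)).
Variables (Omega : set plane) (f : plane -> R[i]).
Hypothesis oO : open Omega.
Hypothesis C1f : C1 Omega f.
Hypothesis f0 : forall z, Omega z -> f z != 0.
Local Notation A := (bergman Omega f).
Local Notation dot := (dotL2b Omega).
Implicit Types (U V W : plane -> B).

Let mO : measurable (Omega : set mplane) := open_plane_measurable oO.

Variable w : nat -> plane -> B.
Hypothesis Aw : forall n, A (w n).
Hypothesis cauchy_w : forall e : R, 0 < e -> exists N, forall m n, (N <= m)%N -> (N <= n)%N ->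
  dot_norm dot (w m - w n) < e.

Let C1w n : C1b Omega (w n).
Proof. by have /(bergmanP f0)[_ ? _ _] := Aw n. Qed.
Let L2w n : L2b Omega (w n).
Proof. by have /(bergmanP f0)[_ _ ? _] := Aw n. Qed.

Let pderivcB v (p q : plane -> R[i]) z : cderivable v p z -> cderivable v q z ->
  pderivc v (fun z => p z - q z) z = pderivc v p z - pderivc v q z.
Proof.
move=> dp dq; have := pderivc_linear (-1) dq dp; rewrite mulN1r addrC => <-.
have -> // : (fun z => -1 * q z + p z) = (fun z => p z - q z).
by apply/funext => t; rewrite mulN1r addrC.
Qed.

(** A complex-valued component of the sequence, together with its derivatives,
    is uniformly Cauchy near each point. *)
Let locally_cauchy (p : (plane -> B) -> plane -> R[i]) (T : R[i] -> R) :
  (p = (fun W => SW W) \/ p = (fun W => VW W)) ->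
  (T = (fun c => complex.Re c) \/ T = (fun c => complex.Im c)) ->
  forall z, Omega z -> exists2 r : R, 0 < r &
   [/\ uniformly_cauchy (ball z r) (fun n z => T (p (w n) z)),
     uniformly_cauchy (ball z r) (fun n => 'D_ex (fun z => T (p (w n) z))) &
     uniformly_cauchy (ball z r) (fun n => 'D_ey (fun z => T (p (w n) z)))].
Proof.
move=> hp hT z Oz.
have [r [C [r0 C0 rO H]]] := bergman_bound oO C1f f0 Oz.
have Cp : 0 < C + 1 by exact: ltr_wpDl.
have T_le c : `|T c| <= nrm c by case: hT => ->; [exact: Re_le_nrm|exact: Im_le_nrm].
have TB c d : T c - T d = T (c - d).
  by case: hT => ->; rewrite ?ReD ?ReN ?ImD ?ImN.
have DT v W t : 'D_v (fun z => T (p W z)) t = T (pderivc v (p W) t) by case: hT => ->.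
have dp n t : Omega t -> cderivable ex (p (w n)) t /\ cderivable ey (p (w n)) t.
  by move=> Ot; have [? ? ? ?] := C1b_cderivable (C1w n) Ot; case: hp => ->.
have pB W1 W2 : p (W1 - W2) = (fun z => p W1 z - p W2 z).
  by case: hp => ->; apply/funext => t.
have key e : 0 < e -> exists N, forall m n t, (N <= m)%N -> (N <= n)%N -> ball z r t ->
    [/\ nrm (p (w m - w n) t) < e, nrm (pderivc ex (p (w m - w n)) t) < e &
        nrm (pderivc ey (p (w m - w n)) t) < e].
  move=> e0; have d0 : 0 < e / (C + 1) by exact: divr_gt0.
  have [N HN] := cauchy_w d0; exists N => m n t Nm Nn zt.
  have Ce : C * (e / (C + 1)) < e.
    by rewrite mulrCA -[ltRHS]mulr1 ltr_pM2l// ltr_pdivrMr// mul1r ltrDl.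
  have AB := bergmanB oO f0 (Aw m) (Aw n).
  have [h1 h2 [h3 h4] [h5 h6]] := H _ _ AB (HN m n Nm Nn) t zt.
  case: hp => ->.
    exact: (And3 (le_lt_trans h1 Ce) (le_lt_trans h3 Ce) (le_lt_trans h4 Ce)).
  exact: (And3 (le_lt_trans h2 Ce) (le_lt_trans h5 Ce) (le_lt_trans h6 Ce)).
exists r => //; split=> e /key[N HN]; exists N => m n t Nm Nn zt;
  have [h1 h2 h3] := HN m n t Nm Nn zt; have Ot := rO t zt;
  have [dm1 dm2] := dp m t Ot; have [dn1 dn2] := dp n t Ot.
- by rewrite TB; apply: le_lt_trans (T_le _) _; move: h1; rewrite pB.
- rewrite !DT TB; apply: le_lt_trans (T_le _) _.
  by move: h2; rewrite pB (pderivcB dm1 dn1).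
- rewrite !DT TB; apply: le_lt_trans (T_le _) _.
  by move: h3; rewrite pB (pderivcB dm2 dn2).
Qed.

(** The pointwise limit; it is [0] off [Omega] because all the [w n] are. *)
Let l : plane -> B := fun z => Bicomplex
  (limn (fun n => complex.Re (Sc (w n z))) +i* limn (fun n => complex.Im (Sc (w n z))))
  (limn (fun n => complex.Re (Vec (w n z))) +i* limn (fun n => complex.Im (Vec (w n z)))).

Let limits :
  C1b Omega l /\ forall z, Omega z ->
  [/\ ccvg (fun n => Sc (w n z)) (Sc (l z)), ccvg (fun n => Vec (w n z)) (Vec (l z)),
      ccvg (fun n => pderivc ex (SW (w n)) z) (pderivc ex (SW l) z) /\
      ccvg (fun n => pderivc ey (SW (w n)) z) (pderivc ey (SW l) z) &
      ccvg (fun n => pderivc ex (VW (w n)) z) (pderivc ex (VW l) z) /\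
      ccvg (fun n => pderivc ey (VW (w n)) z) (pderivc ey (VW l) z)].
Proof.
have [c1 h1] := C1_real_limit oO (fun n => (C1w n).1.1)
  (locally_cauchy (or_introl erefl) (or_introl erefl)).
have [c2 h2] := C1_real_limit oO (fun n => (C1w n).1.2)
  (locally_cauchy (or_introl erefl) (or_intror erefl)).
have [c3 h3] := C1_real_limit oO (fun n => (C1w n).2.1)
  (locally_cauchy (or_intror erefl) (or_introl erefl)).
have [c4 h4] := C1_real_limit oO (fun n => (C1w n).2.2)
  (locally_cauchy (or_intror erefl) (or_intror erefl)).
split; first exact: (conj (conj c1 c2) (conj c3 c4)).
move=> z Oz.
have [a1 b1 d1] := h1 z Oz; have [a2 b2 d2] := h2 z Oz.
have [a3 b3 d3] := h3 z Oz; have [a4 b4 d4] := h4 z Oz.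
split; [exact: (conj a1 a2)|exact: (conj a3 a4)| |].
  by split; [exact: (conj b1 b2)|exact: (conj d1 d2)].
by split; [exact: (conj b3 b4)|exact: (conj d3 d4)].
Qed.

Let C1l : C1b Omega l := limits.1.

Let l_out z : ~ Omega z -> l z = 0.
Proof.
move=> nz; have wz n : w n z = 0 by have /(bergmanP f0)[+ _ _ _] := Aw n; apply.
have E (T : B -> R) : T 0 = 0 -> limn (fun n => T (w n z)) = 0.
  move=> T0; rewrite (_ : (fun n => _) = fun=> 0); first exact: lim_cst.
  by apply/funext => n; rewrite wz.
by rewrite /l (E (fun x => complex.Re (Sc x)))// (E (fun x => complex.Im (Sc x)))//
  (E (fun x => complex.Re (Vec x)))// (E (fun x => complex.Im (Vec x))).
Qed.

Let vekua_l z : Omega z -> vekua_at f l z.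
Proof.
move=> Oz; have [s v [sx sy] [vx vy]] := limits.2 z Oz.
have eqn n : vekua_at f (w n) z by have /(bergmanP f0)[_ _ _] := Aw n; apply.
have cf := ccvg_cst (f z); have cfx := ccvg_cst (pderivc ex f z).
have cfy := ccvg_cst (pderivc ey f z).
split.
  apply: ccvg_unique (ccvgM cf (ccvgD sx (ccvgN vy))) _.
  rewrite (_ : (fun n => _) = fun n => pderivc ex f z * Sc (w n z) + pderivc ey f z * Vec (w n z)).
    exact: (ccvgD (ccvgM cfx s) (ccvgM cfy v)).
  by apply/funext => n; have [] := eqn n.
apply: ccvg_unique (ccvgM cf (ccvgD sy vx)) _.
rewrite (_ : (fun n => _) = fun n => pderivc ey f z * Sc (w n z) - pderivc ex f z * Vec (w n z)).
  exact: (ccvgD (ccvgM cfy s) (ccvgN (ccvgM cfx v))).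
by apply/funext => n; have [] := eqn n.
Qed.

Let sqb_cvg n z : Omega z -> (fun m => sqb (w n z - w m z)) @ \oo --> sqb (w n z - l z).
Proof.
move=> Oz; have [s v _ _] := limits.2 z Oz.
have [sr si] := ccvgD (ccvg_cst (Sc (w n z))) (ccvgN s).
have [vr vi] := ccvgD (ccvg_cst (Vec (w n z))) (ccvgN v).
have E : @sqb R = fun x => complex.Re (Sc x) * complex.Re (Sc x) +
  complex.Im (Sc x) * complex.Im (Sc x) + (complex.Re (Vec x) * complex.Re (Vec x) +
  complex.Im (Vec x) * complex.Im (Vec x)).
  by apply/funext => x; rewrite /sqb !nrm_sqr !expr2.
rewrite E.
exact: (cvgD (cvgD (cvgM sr sr) (cvgM si si)) (cvgD (cvgM vr vr) (cvgM vi vi))).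
Qed.

Let L2bB U V : L2b Omega U -> L2b Omega V -> L2b Omega (U - V).
Proof.
have E (p q : plane -> R[i]) : (fun z => -1 * q z + p z) = (fun z => p z - q z).
  by apply/funext => z; rewrite mulN1r addrC.
move=> [U1 U2] [V1 V2]; split.
  by have := L2_linear mO (-1) V1 U1; rewrite E.
by have := L2_linear mO (-1) V2 U2; rewrite E.
Qed.

(** Fatou's lemma, applied to [w n - w m] as [m] grows. *)
Let integral_limit (c : R) n N : 0 <= c ->
  (forall m, (N <= m)%N -> dot_norm dot (w n - w m) <= c) ->
  (\int[area]_(z in (Omega : set mplane)) (sqb (w n z - l z))%:E <= (c ^+ 2)%:E)%E.
Proof.
move=> c0 H.
apply: (@fatou_le R Omega mO (fun m z => sqb ((w n - w (m + N)%N) z))).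
- move=> m; exact: (sqb_measurable (L2bB (L2w n) (L2w (m + N)%N))).
- by move=> m z _; exact: sqb_ge0.
- by move=> z Oz; have := @sqb_cvg n z Oz; rewrite -(cvg_shiftn N) => h; exact: h.
- move=> m; have := dot_norm_sqr mO (L2bB (L2w n) (L2w (m + N)%N)).
  move=> ->; rewrite lee_fin ler_pXn2r// ?nnegrE ?dot_norm_ge0//.
  by apply: H; rewrite leq_addl.
Qed.

Let measurable_comp (T : B -> R) : 
  (forall n, @measurable_fun _ _ mplane R Omega (fun z => T (w n z))) ->
  (forall z, Omega z -> (fun n => T (w n z)) @ \oo --> T (l z)) ->
  @measurable_fun _ _ mplane R Omega (fun z => T (l z)).
Proof. by move=> mw cw; exact: (@measurable_fun_cvg _ mplane R Omega (fun n z => T (w n z))). Qed.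

Let L2l : L2b Omega l.
Proof.
have [N HN] := cauchy_w ltr01.
have fin := @integral_limit 1 N N ler01 (fun m Nm => ltW (HN N m (leqnn N) Nm)).
have m1 : @measurable_fun _ _ mplane R Omega (fun z => complex.Re (Sc (l z))).
  apply: (measurable_comp (T := fun x => complex.Re (Sc x))).
    by move=> n; have [[]] := L2w n.
  by move=> z Oz; have [[]] := limits.2 z Oz.
have m2 : @measurable_fun _ _ mplane R Omega (fun z => complex.Im (Sc (l z))).
  apply: (measurable_comp (T := fun x => complex.Im (Sc x))).
    by move=> n; have [[]] := L2w n.
  by move=> z Oz; have [[]] := limits.2 z Oz.
have m3 : @measurable_fun _ _ mplane R Omega (fun z => complex.Re (Vec (l z))).
  apply: (measurable_comp (T := fun x => complex.Re (Vec x))).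
    by move=> n; have [_ []] := L2w n.
  by move=> z Oz; have [_ []] := limits.2 z Oz.
have m4 : @measurable_fun _ _ mplane R Omega (fun z => complex.Im (Vec (l z))).
  apply: (measurable_comp (T := fun x => complex.Im (Vec x))).
    by move=> n; have [_ []] := L2w n.
  by move=> z Oz; have [_ []] := limits.2 z Oz.
have [[r1 i1 _] [r2 i2 _]] := L2w N.
have msub (p q : plane -> R[i]) :
    @measurable_fun _ _ mplane R Omega (fun z => complex.Re (p z)) ->
    @measurable_fun _ _ mplane R Omega (fun z => complex.Im (p z)) ->
    @measurable_fun _ _ mplane R Omega (fun z => complex.Re (q z)) ->
    @measurable_fun _ _ mplane R Omega (fun z => complex.Im (q z)) ->
    [/\ @measurable_fun _ _ mplane R Omega (fun z => complex.Re (p z - q z)),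
        @measurable_fun _ _ mplane R Omega (fun z => complex.Im (p z - q z)) &
        @measurable_fun _ _ mplane R Omega (fun z => nrm (p z - q z) ^+ 2)].
  move=> pr pi qr qi.
  have h1 : @measurable_fun _ _ mplane R Omega (fun z => complex.Re (p z - q z)).
    rewrite (_ : (fun z => _) = (fun z => complex.Re (p z) - complex.Re (q z))).
      exact: measurable_funB.
    by apply/funext => z; rewrite ReD ReN.
  have h2 : @measurable_fun _ _ mplane R Omega (fun z => complex.Im (p z - q z)).
    rewrite (_ : (fun z => _) = (fun z => complex.Im (p z) - complex.Im (q z))).
      exact: measurable_funB.
    by apply/funext => z; rewrite ImD ImN.
  split=> //.
  rewrite (_ : (fun z => _) = (fun z => complex.Re (p z - q z) ^+ 2 + complex.Im (p z - q z) ^+ 2)).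
    by apply: measurable_funD; exact: measurable_sq.
  by apply/funext => z; rewrite nrm_sqr.
have [a1 a2 a3] := msub (SW (w N)) (SW l) r1 i1 m1 m2.
have [b1 b2 b3] := msub (VW (w N)) (VW l) r2 i2 m3 m4.
have msq : @measurable_fun _ _ mplane (\bar R) Omega (fun z => (sqb (w N z - l z))%:E).
  by apply/measurable_EFinP; exact: measurable_funD.
have lt (p : plane -> R[i]) : @measurable_fun _ _ mplane R Omega (fun z => nrm (p z) ^+ 2) ->
    (forall z, Omega z -> nrm (p z) ^+ 2 <= sqb (w N z - l z)) ->
    (\int[area]_(z in (Omega : set mplane)) (nrm (p z) ^+ 2)%:E < +oo)%E.
  move=> mp le; apply: (le_lt_trans _ (ltry (1 ^+ 2))); apply: le_trans fin.
  apply: (@ge0_le_integral _ mplane R area Omega mO).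
  - by move=> z _; rewrite lee_fin sqr_ge0.
  - by apply/measurable_EFinP.
  - exact: msq.
  - by move=> z Oz; rewrite lee_fin; exact: le.
have Ld : L2b Omega (w N - l).
  split; split=> //.
    by apply: lt => // z _; rewrite /sqb lerDl sqr_ge0.
  by apply: lt => // z _; rewrite /sqb lerDr sqr_ge0.
rewrite (_ : l = w N - (w N - l)); first exact: L2bB.
by rewrite opprB addrCA subrr addr0.
Qed.

Let Al : A l.
Proof. by apply/(bergmanP f0); split. Qed.

(** The locally uniform limit [l] is also the limit for the norm. *)
Lemma cauchy_limit : exists2 l, A l & (fun n => dot_norm dot (w n - l)) @ \oo --> (0 : R).
Proof.
exists l; first exact: Al.
apply/cvgrPdist_le => e e0; have [N HN] := cauchy_w e0.
exists N => // n /= Nn; rewrite sub0r normrN ger0_norm ?dot_norm_ge0//.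
rewrite -(@ler_pXn2r _ 2)// ?nnegrE ?dot_norm_ge0 ?(ltW e0)// -lee_fin.
rewrite -(dot_norm_sqr mO (L2bB (L2w n) L2l)).
by apply: (integral_limit (N := N) (ltW e0)) => m Nm; exact: ltW (HN n m Nn Nm).
Qed.

End Completeness.

Unset Implicit Arguments.

Theorem theorem12 (R : realType) (Omega : set (R * R)) (f : R * R -> R[i]) :
  bounded_domain Omega ->
  C1_closure Omega f ->
  (forall z, Omega z -> f z <> 0) ->
  complex_hilbert_space (bergman Omega f) (dotL2b Omega).
Proof.
move=> [_ oO _ _] [[C1r _ _ _] [C1i _ _ _]] fn0.
have C1f : C1 Omega f by split.
have f0 z : Omega z -> f z != 0 by move=> /fn0 /eqP.
split.
- exact: bergman_subspace.
- exact: bergman_inner_product.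
- by move=> w Aw cw; exact: cauchy_limit.
Qed.
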